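(* Let $R$ be an integral domain, $n=2$, and let $f\in R[x_1,x_2]$ satisfy $\deg_{x_i}f>0$ for $i=1,2$ and $\deg_{\mathbf{w}(f)}f=(\deg_{x_1}f)(\deg_{x_2}f)$. If $f$ is tamely reduced over $R$, then: (i) if $\deg_{x_1}f=\deg_{x_2}f$, then $H(f)\subseteq\mathrm{Aff}(R,\mathbf{x})$; (ii) if $\deg_{x_i}f>\deg_{x_j}f$ for $i,j\in\{1,2\}$, $i\ne j$, then $H(f)\subseteq J(R;x_i,x_j)$.
   Context: $\mathrm{Aff}(R,\mathbf{x})$, $\mathrm{T}(R,\mathbf{x})$: subgroups of $\mathrm{Aut}(R[x_1,x_2]/R)$ generated by affine automorphisms ($\deg\phi(x_i)=1$ for all $i$), resp. by affine and elementary automorphisms (elementary: fixing all variables but one). $\mathbf{w}(f)=(\deg_{x_2}f,\deg_{x_1}f)\in\mathbb{Z}^2$, and $\deg_{\mathbf{w}}$ is the weighted degree giving $x_1,x_2$ weights $w_1,w_2$. $f\in R[\mathbf{x}]\setminus R$ is tamely reduced over $R$ if $\deg_{x_1}\tau(f)+\deg_{x_2}\tau(f)\ge\deg_{x_1}f+\deg_{x_2}f$ for every $\tau\in\mathrm{T}(R,\mathbf{x})$. $H(f)=\mathrm{Aut}(R[\mathbf{x}]/R[f])\cap\mathrm{T}(R,\mathbf{x})$. $J(R;x_i,x_j)$ is the set of $\phi\in\mathrm{Aut}(R[\mathbf{x}]/R)$ with $\phi(R[x_i])\subseteq R[x_i]$. *)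

(* Defs.v *)
From HB Require Import structures.
From mathcomp Require Import all_boot all_order all_algebra.
From mathcomp Require Import mpoly.
Set Implicit Arguments. Unset Strict Implicit. Unset Printing Implicit Defensive.
Import Order.TTheory GRing.Theory.
Local Open Scope ring_scope.

(* Polynomials R[x_1,x_2] are {mpoly R[2]}; x_1 = 'X_0, x_2 = 'X_1. *)

Definition degx (R : ringType) (i : 'I_2) (f : {mpoly R[2]}) : nat :=
  \max_(m <- msupp f) m i.

Definition wdeg (R : ringType) (w : nat * nat) (f : {mpoly R[2]}) : nat :=
  \max_(m <- msupp f) (w.1 * m ord0 + w.2 * m (@Ordinal 2 1 isT))%N.

Definition tdeg (R : ringType) (f : {mpoly R[2]}) : nat := (msize f).-1.

Definition is_aut (R : comRingType) (F : {mpoly R[2]} -> {mpoly R[2]}) : Prop :=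
  (exists phi : 2.-tuple {mpoly R[2]}, forall p, F p = comp_mpoly phi p)
  /\ bijective F.

Definition is_affine (R : comRingType) (F : {mpoly R[2]} -> {mpoly R[2]}) : Prop :=
  is_aut F /\ forall i : 'I_2, tdeg (F 'X_i) = 1%N.

Definition is_elementary (R : comRingType) (F : {mpoly R[2]} -> {mpoly R[2]}) : Prop :=
  is_aut F /\ exists i : 'I_2, forall j : 'I_2, j != i -> F 'X_j = 'X_j.

Inductive in_T (R : comRingType) : ({mpoly R[2]} -> {mpoly R[2]}) -> Prop :=
  | T_aff F : is_affine F -> in_T F
  | T_elem F : is_elementary F -> in_T F
  | T_comp F G : in_T F -> in_T G -> in_T (F \o G)
  | T_inv F G : in_T F -> cancel F G -> cancel G F -> in_T G
  | T_ext F G : in_T F -> F =1 G -> in_T G.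

Definition tamely_reduced (R : comRingType) (f : {mpoly R[2]}) : Prop :=
  (1 < msize f)%N (* f \notin R *) /\
  forall tau, in_T tau ->
    (degx ord0 f + degx (@Ordinal 2 1 isT) f <=
     degx ord0 (tau f) + degx (@Ordinal 2 1 isT) (tau f))%N.

(* H(f) = Aut(R[x]/R[f]) \cap T(R,x) *)
Definition in_H (R : comRingType) (f : {mpoly R[2]}) (F : {mpoly R[2]} -> {mpoly R[2]}) : Prop :=
  is_aut F /\ F f = f /\ in_T F.

Definition in_Rxi (R : ringType) (i : 'I_2) (p : {mpoly R[2]}) : Prop :=
  forall m, m \in msupp p -> forall j : 'I_2, j != i -> m j = 0%N.

Definition in_J (R : comRingType) (i : 'I_2) (F : {mpoly R[2]} -> {mpoly R[2]}) : Prop :=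
  is_aut F /\ forall p, in_Rxi i p -> in_Rxi i (F p).

(* Main.v *)
(* A polynomial map (F_1, F_2) coming from a tame automorphism is, up to an invertible
   affine change of coordinates, either affine or of the form (P, Q + r(P)) with (P, Q)
   again tame, deg Q <= deg P and deg r >= 2; so its leading forms are proportional, or
   one is c times a power of the other, with c in R.  The Newton polygon of f is the
   triangle spanned by 0, x_1^d1 and x_2^d2.  If F fixes f, then either the leading terms
   of F_1^d1 and F_2^d2 do not cancel in f(F_1, F_2) = f, which bounds the degrees of F_1
   and F_2, or they cancel, and then the constants relating the leading forms give a zero
   of the edge polynomial of f, i.e. a linear or elementary automorphism that lowers a
   degree of f, against reducedness. *)
Require Import Defs.
From HB Require Import structures.
From mathcomp Require Import all_boot all_order all_algebra.
From mathcomp Require Import mpoly.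
From mathcomp Require Import ring zify.
Set Implicit Arguments. Unset Strict Implicit. Unset Printing Implicit Defensive.
Import GRing.Theory.
Local Open Scope ring_scope.

(** * Leading coefficients on the edge of the Newton triangle *)

(** Since [R] is only a domain, a zero of the edge polynomial over the fraction field would not
    suffice: the lowering automorphism and its inverse must be defined over [R]. The affine changes
    in the description of tame pairs are invertible over [R], so after scaling the zero is either a
    column of an invertible matrix or a point [(1, c)] with [c] in [R], and both are reached by
    automorphisms tame over [R]. All degree counts use one device, ring morphisms [chi] from [{mpoly
    R[2]}] to polynomials in one variable over a domain: [psi] isolates the degree in one variable,
    [phi] the total degree. For unequal degrees d_i > d_j the total degree only shows that F_i is
    affine and leaves a possible x_j term in it. A third morphism, restriction to the line x_i = 0,
    where f has degree at most d_j, excludes that term. *)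

Lemma size_mul_coef (A : comNzRingType) (u v : {poly A}) p q :
  (size u <= p.+1)%N -> (size v <= q.+1)%N ->
  (size (u * v)%R <= (p + q).+1)%N /\ (u * v)`_(p + q) = u`_p * v`_q.
Proof.
move=> su sv; split.
  apply: leq_trans (size_polyMleq _ _) _.
  move: (size u) (size v) su sv => a b su sv; lia.
have lt_p : (p < (p + q).+1)%N by lia.
rewrite coefM (bigD1 (Ordinal lt_p)) //= addKn big1 ?addr0 // => k nk.
have {}nk : (k : nat) != p by apply: contra nk => /eqP e; apply/eqP/val_inj.
have [lt|ge] := ltnP k p; last first.
  by rewrite nth_default ?mul0r //; apply: leq_trans su _; rewrite ltn_neqAle eq_sym nk.
rewrite [v`__]nth_default ?mulr0 //; apply: leq_trans sv _; lia.
Qed.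

Lemma size_exp_coef (A : comNzRingType) (u : {poly A}) p n :
  (size u <= p.+1)%N ->
  (size (u ^+ n)%R <= (n * p).+1)%N /\ (u ^+ n)`_(n * p) = u`_p ^+ n.
Proof.
move=> su; elim: n => [|n [sn cn]].
  by rewrite !expr0 mul0n size_poly1 coef1.
by rewrite !exprS -cn mulSn; apply: size_mul_coef.
Qed.

Lemma size_monom_coef (A : comNzRingType) (u v : {poly A}) p q n m :
  (size u <= p.+1)%N -> (size v <= q.+1)%N ->
  (size (u ^+ n * v ^+ m)%R <= (n * p + m * q).+1)%N /\
  (u ^+ n * v ^+ m)%R`_(n * p + m * q) = u`_p ^+ n * v`_q ^+ m.
Proof.
move=> su sv; have [s1 <-] := size_exp_coef n su.
have [s2 <-] := size_exp_coef m sv; exact: size_mul_coef.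
Qed.

Lemma ord2P (i j k : 'I_2) : i != j -> k != i -> k = j.
Proof.
case: i => -[|[|[]]] //= ?; case: j => -[|[|[]]] //= ?; case: k => -[|[|[]]] //= ?;
  by move=> ? ?; apply/val_inj.
Qed.

Lemma ord2_other (i : 'I_2) : exists j : 'I_2, i != j.
Proof. by exists (ordS i); case: i => -[|[|[]]]. Qed.

Lemma big_ord2P (T : Type) (idx : T) (op : Monoid.com_law idx) (i j : 'I_2)
    (F : 'I_2 -> T) :
  i != j -> \big[op/idx]_k F k = op (F i) (F j).
Proof.
move=> nij; rewrite (bigD1 i) //= (bigD1 j) //=; last by rewrite eq_sym.
rewrite big1 ?Monoid.mulm1 // => k /andP [ki /negP kj].
by case: kj; rewrite (ord2P nij ki).
Qed.

Lemma morph_mpoly2E (R B : comNzRingType) (iota : {rmorphism R -> B})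
    (chi : {rmorphism {mpoly R[2]} -> B}) (i j : 'I_2) (f : {mpoly R[2]}) :
  i != j -> (forall c, chi c%:MP = iota c) ->
  chi f = \sum_(m <- msupp f) iota f@_m * (chi 'X_i ^+ m i * chi 'X_j ^+ m j).
Proof.
move=> nij chiC; rewrite {1}[f]mpolyE rmorph_sum; apply: eq_bigr => m _.
rewrite -mul_mpolyC rmorphM chiC /=; congr (_ * _).
by rewrite mpolyXE_id (big_ord2P _ _ nij) rmorphM !rmorphXn.
Qed.

Section Triangle.
Variables (R : idomainType) (i j : 'I_2) (nij : i != j).
Variables (f : {mpoly R[2]}) (di dj : nat).
Hypothesis tri : forall m, m \in msupp f -> (dj * m i + di * m j <= di * dj)%N.

(* The part of f on the edge from x_i^di to x_j^dj of its Newton polygon, evaluated at (a, b). *)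
Definition wtop (A : idomainType) (iota : R -> A) (a b : A) : A :=
  \sum_(m <- msupp f | (dj * m i + di * m j == di * dj)%N)
     iota f@_m * (a ^+ m i * b ^+ m j).

(** By [di * k = dj * l], all monomials on the edge have the same weight [di * k] for the weights
    [k] and [l], so the edge part is weighted homogeneous. *)
Lemma wtop_scale (A : idomainType) (iota : R -> A) (a b s : A) k l :
  (di * k = dj * l)%N -> (0 < di)%N -> (0 < dj)%N ->
  wtop iota (s ^+ k * a) (s ^+ l * b) = s ^+ (di * k) * wtop iota a b.
Proof.
move=> ekl di0 dj0; rewrite /wtop mulr_sumr; apply: eq_bigr => m /eqP em.
have -> : (di * k = k * m i + l * m j)%N.
  apply/eqP; rewrite -(eqn_pmul2l dj0); apply/eqP; nia.
rewrite !exprMn exprD !exprM; ring.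
Qed.

Variables (A : idomainType) (iota : {rmorphism R -> A}).
Variable chi : {rmorphism {mpoly R[2]} -> {poly A}}.
Hypothesis chiC : forall c, chi c%:MP = (iota c)%:P.

Let chiE : chi f =
  \sum_(m <- msupp f) (iota f@_m)%:P * (chi 'X_i ^+ m i * chi 'X_j ^+ m j).
Proof. exact: (@morph_mpoly2E _ _ (polyC \o iota) chi i j f nij chiC). Qed.

Let monom_le m p q mu : m \in msupp f -> (di * p <= mu)%N -> (dj * q <= mu)%N ->
  (0 < di)%N -> (0 < dj)%N -> (m i * p + m j * q <= mu)%N.
Proof.
move=> /tri tm hp hq di0 dj0.
(* After multiplication by [di * dj] the degree reads [dj * m i * (di * p) + di * m j * (dj * q)],
   so both bounds and [tri] apply without division. *)
have h : (di * dj * (m i * p + m j * q) <= di * dj * mu)%N.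
  apply: (@leq_trans ((dj * m i + di * m j) * mu)); last by rewrite leq_mul2r tm orbT.
  nia.
by rewrite leq_pmul2l ?muln_gt0 ?di0 // in h.
Qed.

Lemma size_triangle p q mu : (0 < di)%N -> (0 < dj)%N ->
  (size (chi 'X_i) <= p.+1)%N -> (size (chi 'X_j) <= q.+1)%N ->
  (di * p <= mu)%N -> (dj * q <= mu)%N -> (size (chi f) <= mu.+1)%N.
Proof.
move=> di0 dj0 sp sq hp hq; rewrite chiE; apply: leq_trans (size_sum _ _ _) _.
rewrite big_seq; apply/bigmax_leqP_seq => m mf _.
rewrite mul_polyC; apply: leq_trans (size_scale_leq _ _) _.
have [s _] := size_monom_coef (m i) (m j) sp sq.
by apply: leq_trans s _; rewrite ltnS monom_le.
Qed.

(** Off the edge the inequality [tri] is strict, and [0 < mu] turns this into a degree strictly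
    below [mu]; hence only edge monomials contribute, each by its leading coefficients. *)
Lemma coef_triangle p q mu : (0 < di)%N -> (0 < dj)%N -> (0 < mu)%N ->
  (size (chi 'X_i) <= p.+1)%N -> (size (chi 'X_j) <= q.+1)%N ->
  (di * p = mu)%N -> (dj * q = mu)%N ->
  (chi f)`_mu = wtop iota (chi 'X_i)`_p (chi 'X_j)`_q.
Proof.
move=> di0 dj0 mu0 sp sq hp hq; rewrite chiE coef_sum /wtop [RHS]big_mkcond.
rewrite [LHS]big_seq [RHS]big_seq; apply: eq_bigr => m mf.
have [s c] := size_monom_coef (m i) (m j) sp sq.
have e : (di * dj * (m i * p + m j * q) = (dj * m i + di * m j) * mu)%N by nia.
rewrite coefCM; case: eqP => [em|nm].
  suff <- : (m i * p + m j * q = mu)%N by rewrite c.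
  by apply/eqP; rewrite -(eqn_pmul2l (_ : 0 < di * dj)%N) ?muln_gt0 ?di0 // e em.
rewrite nth_default ?mulr0 //; apply: leq_trans s _.
have := monom_le mf (eq_leq hp) (eq_leq hq) di0 dj0.
rewrite leq_eqVlt => /orP [/eqP e2|//].
case: nm; apply/eqP; rewrite -(eqn_pmul2r mu0) -e e2; lia.
Qed.

Hypothesis iota_inj : injective iota.

(** The image of the corner x_i^di has degree [di * p], which no other monomial of the triangle
    reaches, so its leading term survives in [chi f]. *)
Lemma dominant_corner p q : (0 < di)%N -> (0 < dj)%N ->
  f@_(U_(i) *+ di)%MM != 0 ->
  size (chi 'X_i) = p.+1 -> (size (chi 'X_j) <= q.+1)%N ->
  (dj * q < di * p)%N -> (di * p < size (chi f))%N.
Proof.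
move=> di0 dj0 corner sp sq lt.
suff: (chi f)`_(di * p) != 0.
  by apply: contraR; rewrite -leqNgt => h; rewrite nth_default.
have mi : (U_(i) *+ di)%MM i = di by rewrite mulmnE mnm1E eqxx mul1n.
have mj : (U_(i) *+ di)%MM j = 0%N by rewrite mulmnE mnm1E (negbTE nij).
have sp' : (size (chi 'X_i) <= p.+1)%N by rewrite sp.
rewrite chiE (big_rem (U_(i) *+ di)%MM) ?mcoeff_msupp //= mi mj coefD.
have [_ c] := size_monom_coef di 0 sp' sq.
rewrite coefCM mul0n addn0 in c *; rewrite c coef_sum [X in _ + X]big_seq big1.
  rewrite addr0 expr0 mulr1 mulf_neq0 //.
    by rewrite raddf_eq0.
  by rewrite expf_neq0 // -[p]/(p.+1.-1) -sp -lead_coefE lead_coef_eq0 -size_poly_eq0 sp.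
move=> m; rewrite (rem_filter _ (msupp_uniq f)) mem_filter /= => /andP [nm mf].
have [s _] := size_monom_coef (m i) (m j) sp' sq.
rewrite coefCM nth_default ?mulr0 //; apply: leq_trans s _.
have tm := tri mf.
(* On the x_i axis another monomial has a smaller exponent. Off it, [tri] trades each factor x_j
   against [di] in [dj * m i], and [dj * q < di * p] makes this a strict loss. *)
have [mj0|mj0] := posnP (m j).
  have : (m i != di).
    apply: contra nm => /eqP mie; apply/eqP/mnmP => k.
    by have [->|/(ord2P nij)->] := eqVneq k i; rewrite ?mi ?mj.
  rewrite mj0 in tm *; rewrite mul0n addn0.
  have : (m i <= di)%N by rewrite -(leq_pmul2l dj0); lia.
  move=> h1 h2; have {h1 h2} : (m i < di)%N by lia.
  nia.
rewrite -(ltn_pmul2l dj0); nia.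
Qed.
End Triangle.

(** * Tame automorphisms lowering the degree *)

Lemma comp_mpolyXt (R : comNzRingType) n k (t : n.-tuple {mpoly R[k]}) l :
  'X_l \mPo t = tnth t l.
Proof. by rewrite comp_mpolyXU (tnth_nth 0). Qed.

Lemma morph_mpoly2_eq (R B : comNzRingType) (iota : {rmorphism R -> B})
    (chi chi' : {rmorphism {mpoly R[2]} -> B}) (f : {mpoly R[2]}) :
  (forall c, chi c%:MP = iota c) -> (forall c, chi' c%:MP = iota c) ->
  (forall k, chi 'X_k = chi' 'X_k) -> chi f = chi' f.
Proof.
move=> h h' hX; have n01 : ord0 != ord_max :> 'I_2 by [].
by rewrite (morph_mpoly2E _ n01 h) (morph_mpoly2E _ n01 h') !hX.
Qed.

Definition pair2 (T : Type) (i : 'I_2) (a b : T) : 2.-tuple T :=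
  [tuple if k == i then a else b | k < 2].

Lemma pair2l T i (a b : T) : tnth (pair2 i a b) i = a.
Proof. by rewrite tnth_mktuple eqxx. Qed.

Lemma pair2r T i j (a b : T) : i != j -> tnth (pair2 i a b) j = b.
Proof. by move=> nij; rewrite tnth_mktuple eq_sym (negbTE nij). Qed.

Lemma comp_mpolyK (R : comNzRingType) (s t : 2.-tuple {mpoly R[2]}) :
  (forall k, tnth t k \mPo s = 'X_k) -> cancel (comp_mpoly t) (comp_mpoly s).
Proof.
move=> h p.
apply: (@morph_mpoly2_eq _ _ (@mpolyC 2 R) (comp_mpoly s \o comp_mpoly t) idfun) => //=.
- by move=> c; rewrite !comp_mpolyC.
- by move=> k; rewrite comp_mpolyXt h.
Qed.

Lemma is_aut_comp (R : comNzRingType) (s t : 2.-tuple {mpoly R[2]}) :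
  (forall k, tnth t k \mPo s = 'X_k) -> (forall k, tnth s k \mPo t = 'X_k) ->
  is_aut (comp_mpoly t).
Proof.
move=> h1 h2; split; first by exists t.
by exists (comp_mpoly s); apply: comp_mpolyK.
Qed.

Section Elementary.
Variables (R : comNzRingType) (i j : 'I_2) (nij : i != j).

(** The hypothesis says that [r] does not involve x_j, in the form needed to check that x_j - r
    gives the inverse: it is applied with [a] equal to [r] and to [- r]. *)
Lemma elementary_in_T (r : {mpoly R[2]}) :
  (forall a, r \mPo pair2 j ('X_j + a) 'X_i = r) ->
  in_T (comp_mpoly (pair2 j ('X_j + r) 'X_i)).
Proof.
have nji : j != i by rewrite eq_sym.
have case2 (P : 'I_2 -> Prop) : P i -> P j -> forall k, P k.
  by move=> pi pj k; have [->|/(ord2P nij)->] := eqVneq k i.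
move=> rE; apply: T_elem; split.
  apply: (@is_aut_comp _ (pair2 j ('X_j - r) 'X_i)); apply: case2;
    rewrite ?pair2l ?(pair2r _ _ nji) ?comp_mpolyXt ?(pair2r _ _ nji) //.
    by rewrite rmorphD /= comp_mpolyXt pair2l rE subrK.
  by rewrite rmorphB /= comp_mpolyXt pair2l rE addrK.
by exists j => k /(ord2P nji) ->; rewrite comp_mpolyXt pair2r.
Qed.

Lemma mcoeff_affine (a b e : R) (k : 'I_2) :
  (a%:MP * 'X_i + b%:MP * 'X_j + e%:MP : {mpoly R[2]})@_U_(k) =
  if k == i then a else b.
Proof.
rewrite !mcoeffD !mcoeffCM !mcoeffXU mcoeffC mnm1_eq0 mulr0 addr0.
have [->|/(ord2P nij)->] := eqVneq k i; rewrite ?eqxx ?(negbTE nij).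
  by rewrite eq_sym (negbTE nij) mulr0 mulr1 addr0.
by rewrite mulr0 mulr1 add0r.
Qed.

Lemma tdeg_affine (a b e : R) : (a != 0) || (b != 0) ->
  tdeg (a%:MP * 'X_i + b%:MP * 'X_j + e%:MP : {mpoly R[2]}) = 1%N.
Proof.
move=> nab; set p := (X in tdeg X).
have le2 : (msize p <= 2)%N.
  rewrite /p; apply: leq_trans (msizeD_le _ _) _; rewrite geq_max.
  rewrite msizeC (leq_trans (leq_b1 _)) ?andbT //.
  apply: leq_trans (msizeD_le _ _) _; rewrite geq_max !mul_mpolyC.
  by rewrite !(leq_trans (msizeZ_le _ _)) // msizeX mdeg1.
suff: (1 < msize p)%N by rewrite /tdeg; case: (msize p) le2 => [|[|[|]]].
have [k] : exists k, k \in [:: i; j] /\ p@_U_(k) != 0.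
  case/orP: nab => n0; [exists i | exists j]; rewrite mcoeff_affine !inE ?eqxx ?orbT //.
  by rewrite [j == i]eq_sym (negbTE nij).
by case=> _; rewrite -mcoeff_msupp => /msize_mdeg_lt; rewrite mdeg1.
Qed.

Lemma linear_in_T (a b c d u : R) : u * (a * d - b * c) = 1 ->
  in_T (comp_mpoly (pair2 i (a%:MP * 'X_i + b%:MP * 'X_j)
                           (c%:MP * 'X_i + d%:MP * 'X_j) : 2.-tuple {mpoly R[2]})).
Proof.
move=> udet.
have case2 (P : 'I_2 -> Prop) : P i -> P j -> forall k, P k.
  by move=> pi pj k; have [->|/(ord2P nij)->] := eqVneq k i.
apply: T_aff; split.
  (* The inverse is the adjugate matrix times [u], the inverse of the determinant. *)
  apply: (@is_aut_comp _ (pair2 i ((u * d)%:MP * 'X_i + (- u * b)%:MP * 'X_j)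
                                  ((- u * c)%:MP * 'X_i + (u * a)%:MP * 'X_j)));
  apply: case2; rewrite ?pair2l ?(pair2r _ _ nij) !(rmorphD, rmorphM) /=
    !comp_mpolyC !comp_mpolyXt !pair2l !(pair2r _ _ nij) !(rmorphM, rmorphN) /=.
  - transitivity ((u * (a * d - b * c))%:MP * 'X_i : {mpoly R[2]}); last by rewrite udet mul1r.
    rewrite !(rmorphM, rmorphB) /=; ring.
  - transitivity ((u * (a * d - b * c))%:MP * 'X_j : {mpoly R[2]}); last by rewrite udet mul1r.
    rewrite !(rmorphM, rmorphB) /=; ring.
  - transitivity ((u * (a * d - b * c))%:MP * 'X_i : {mpoly R[2]}); last by rewrite udet mul1r.
    rewrite !(rmorphM, rmorphB) /=; ring.
  - transitivity ((u * (a * d - b * c))%:MP * 'X_j : {mpoly R[2]}); last by rewrite udet mul1r.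
    rewrite !(rmorphM, rmorphB) /=; ring.
apply: case2; rewrite comp_mpolyXt ?pair2l ?(pair2r _ _ nij) -[X in tdeg X]addr0 -mpolyC0
  tdeg_affine //; apply/negP => /negP; rewrite negb_or !negbK => /andP [/eqP e1 /eqP e2];
  move: udet; rewrite e1 e2 ?(mul0r, mulr0) subrr mulr0 => /esym /eqP; by rewrite oner_eq0.
Qed.
End Elementary.

Section Bidegree.
Variables (R : idomainType).

(* R[x_1,x_2] seen as R[x_j][x_i]: 'X stands for x_i and 'X%:P for x_j. *)
Definition psi (i : 'I_2) : {mpoly R[2]} -> {poly {poly R}} :=
  mmap (polyC \o polyC) (fun k => if k == i then 'X else 'X%:P).
HB.instance Definition _ i := GRing.RMorphism.on (psi i).

Lemma psiC i c : psi i c%:MP = c%:P%:P.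
Proof. by rewrite /psi mmapC. Qed.

Lemma psiXi i : psi i 'X_i = 'X.
Proof. by rewrite /psi mmapX mmap1U eqxx. Qed.

Lemma psiXj i j : i != j -> psi i 'X_j = 'X%:P.
Proof. by move=> nij; rewrite /psi mmapX mmap1U eq_sym (negbTE nij). Qed.

Lemma coef_psi (i j : 'I_2) (f : {mpoly R[2]}) (m : 'X_{1..2}) :
  i != j -> (psi i f)`_(m i)`_(m j) = f@_m.
Proof.
move=> nij; have -> : psi i f = \sum_(l <- msupp f) (f@_l)%:P%:P * ('X^(l i) * ('X^(l j))%:P).
  rewrite [LHS](@morph_mpoly2E R {poly {poly R}} (polyC \o polyC) (psi i) i j f nij (psiC i)).
  by apply: eq_bigr => l _; rewrite /= psiXi (psiXj nij) rmorphXn.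
have cE (l : 'X_{1..2}) : ((f@_l)%:P%:P * ('X^(l i) * ('X^(l j))%:P))`_(m i)`_(m j)
    = f@_l * ((m i == l i)%:R * (m j == l j)%:R).
  by rewrite coefCM coefMC coefXn coefCM -polyC_natr coefCM coefXn.
rewrite !coef_sum; under eq_bigr => l _ do rewrite cE.
rewrite -[RHS]mulr1 (bigID (pred1 m)) /= addrC big1 ?add0r.
  have [mf|mf] := boolP (m \in msupp f).
    rewrite -big_filter (perm_big [:: m]) ?big_seq1 ?eqxx ?mulr1 //.
    apply: uniq_perm => //; first by rewrite filter_uniq ?msupp_uniq.
    by move=> l; rewrite mem_filter inE /=; case: eqP => // ->.
  rewrite (memN_msupp_eq0 mf) mul0r big1_seq // => l /andP [/eqP -> h].
  by rewrite h in mf.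
move=> l nlm; case: eqP => e1; rewrite ?mul0r ?mulr0 //.
case: eqP => e2; rewrite ?mulr0 //; case/eqP: nlm; apply/mnmP => k.
by have [->|/(ord2P nij)->] := eqVneq k i.
Qed.

Lemma psi_inj i : injective (psi i).
Proof.
move=> f g e; apply/mpolyP => m.
have [j nij] := ord2_other i.
by rewrite -!(coef_psi _ _ nij) e.
Qed.

Lemma degx_psi i (f : {mpoly R[2]}) n :
  (size (psi i f) <= n.+1)%N -> (degx i f <= n)%N.
Proof.
move=> s; apply/bigmax_leqP_seq => m mf _; rewrite leqNgt; apply/negP => lt.
have [j nij] := ord2_other i.
move: mf; rewrite mcoeff_msupp -(coef_psi _ _ nij) [(psi i f)`__]nth_default ?coef0 ?eqxx //.
exact: leq_trans s lt.
Qed.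
End Bidegree.

(** * Reducedness as nonvanishing of the edge polynomial *)

Section Reduced.
Variables (R : idomainType) (i j : 'I_2) (nij : i != j).
Variables (f : {mpoly R[2]}) (di dj : nat).
Hypothesis tri : forall m, m \in msupp f -> (dj * m i + di * m j <= di * dj)%N.
Hypotheses (di0 : (0 < di)%N) (dj0 : (0 < dj)%N).
Hypothesis reduced :
  forall tau, in_T tau -> (di + dj <= degx i (tau f) + degx j (tau f))%N.

(** The coefficient of x_i^di in the image of [f] is the edge part at two coefficients, which are
    polynomials in x_j. Were it zero, the degree in x_i would fall below [di], while the bounds by
    [p'] and [q'] keep the degree in x_j at most [dj]: the sum of degrees would drop. *)
Lemma reduced_wtop (t : 2.-tuple {mpoly R[2]}) q p' q' :
  in_T (comp_mpoly t) ->
  (size (psi i (tnth t i)) <= 2)%N -> (size (psi i (tnth t j)) <= q.+1)%N ->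
  (size (psi j (tnth t i)) <= p'.+1)%N -> (size (psi j (tnth t j)) <= q'.+1)%N ->
  (dj * q = di)%N -> (di * p' <= dj)%N -> (dj * q' <= dj)%N ->
  wtop i j f di dj polyC (psi i (tnth t i))`_1 (psi i (tnth t j))`_q != 0.
Proof.
move=> tT s1 s2 s3 s4 eq1 le1 le2; apply/negP => /eqP w0.
have := reduced tT; apply/negP; rewrite -ltnNge.
have chiC k c : (psi k \o comp_mpoly t) c%:MP = (c%:P)%:P by rewrite /= comp_mpolyC psiC.
have lej : (degx j (comp_mpoly t f) <= dj)%N.
  apply: degx_psi.
  by apply: (@size_triangle R i j nij f di dj tri _ polyC (psi j \o comp_mpoly t)
             (chiC j) p' q') => //=; rewrite comp_mpolyXt.
suff lti : (degx i (comp_mpoly t f) < di)%N by rewrite -addSn leq_add.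
have s1' : (size ((psi i \o comp_mpoly t) 'X_i) <= 2)%N by rewrite /= comp_mpolyXt.
have s2' : (size ((psi i \o comp_mpoly t) 'X_j) <= q.+1)%N by rewrite /= comp_mpolyXt.
have sf : (size ((psi i \o comp_mpoly t) f) <= di.+1)%N.
  by apply: (@size_triangle R i j nij f di dj tri _ polyC _ (chiC i) 1 q);
    rewrite ?muln1 ?eq1.
have cf : ((psi i \o comp_mpoly t) f)`_di = 0.
  rewrite (@coef_triangle R i j nij f di dj tri _ polyC _ (chiC i) 1 q) ?muln1 //.
  by rewrite /= !comp_mpolyXt.
case: di di0 sf cf => // n _ sf cf; rewrite ltnS; apply: degx_psi.
rewrite leqNgt; apply/negP => lt.
have {lt sf} /eqP e : size ((psi i \o comp_mpoly t) f) == n.+2 by rewrite eqn_leq sf.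
have : lead_coef ((psi i \o comp_mpoly t) f) == 0 by rewrite lead_coefE e cf.
by rewrite lead_coef_eq0 -size_poly_eq0 e.
Qed.

(** A zero at [(1, c)] would let the shear x_j -> x_j + c x_i^k cancel the term x_i^di. *)
Lemma reduced_shear (c : R) k : di = (dj * k)%N ->
  wtop i j f di dj polyC 1 c%:P != 0.
Proof.
move=> e; pose t := pair2 j ('X_j + c%:MP * 'X_i ^+ k) ('X_i : {mpoly R[2]}).
have nji : j != i by rewrite eq_sym.
have k0 : (0 < k)%N by move: di0; rewrite e muln_gt0 dj0.
have ti : tnth t i = 'X_i by rewrite pair2r.
have tj : tnth t j = 'X_j + c%:MP * 'X_i ^+ k by rewrite pair2l.
have pj : psi i (tnth t j) = c%:P *: 'X^k + 'X%:P.
  by rewrite tj rmorphD rmorphM rmorphXn /= psiC psiXi (psiXj _ nij) mul_polyC addrC.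
have := @reduced_wtop t k 0 1.
rewrite pj ti psiXi coefD coefX coefZ coefXn !eqxx mulr1 coefC gtn_eqF // addr0.
apply; rewrite ?muln0 ?muln1 //.
- apply: (elementary_in_T nij) => a.
  by rewrite rmorphM rmorphXn /= comp_mpolyC comp_mpolyXt pair2r.
- by rewrite size_polyX.
- apply: leq_trans (size_polyD _ _) _; rewrite geq_max.
  rewrite (leq_trans (size_scale_leq _ _)) ?size_polyXn //=.
  by rewrite (leq_trans (size_polyC_leq1 _)).
- by rewrite (psiXj _ nji) size_polyC_leq1.
rewrite tj rmorphD rmorphM rmorphXn /= psiC psiXi (psiXj _ nji) -rmorphXn -rmorphM /=.
apply: leq_trans (size_polyD _ _) _; rewrite geq_max size_polyX /=.
by rewrite (leq_trans (size_polyC_leq1 _)).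
Qed.

(** The pair [(a, c)] collects the coefficients of x_i in the images of both variables under a
    linear automorphism; a zero there would cancel x_i^di. *)
Lemma reduced_linear (a b c d : R) : di = dj -> (a * d - b * c) \is a GRing.unit ->
  wtop i j f di dj polyC a%:P c%:P != 0.
Proof.
move=> e u; have nji : j != i by rewrite eq_sym.
have tT := @linear_in_T R i j nij a b c d _ (mulVr u).
set t := pair2 _ _ _ in tT.
have pE k l x y : k != l -> psi k (x%:MP * 'X_k + y%:MP * 'X_l) = x%:P *: 'X + (y *: 'X)%:P :> {poly {poly R}}.
  by move=> nkl; rewrite rmorphD !rmorphM /= !psiC psiXi (psiXj _ nkl) mul_polyC -polyCM mul_polyC.
have sE (x : {poly R}) (y : {poly R}) : (size (x *: 'X + y%:P)%R <= 2)%N.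
  apply: leq_trans (size_polyD _ _) _; rewrite geq_max.
  by rewrite (leq_trans (size_scale_leq _ _)) ?size_polyX //= (leq_trans (size_polyC_leq1 _)).
have := @reduced_wtop t 1 1 1 tT; rewrite pair2l (pair2r _ _ nij) !(pE i j) //.
rewrite ![_ + _%:MP * 'X_j]addrC !(pE j i) // !sE !muln1 !coefD !coefZ !coefX !coefC /= !mulr1 !addr0.
by apply; rewrite // e.
Qed.
End Reduced.

(** * Degree structure of tame automorphisms *)

Definition affine_image (R : comUnitRingType) (P Q P' Q' : {mpoly R[2]}) : Prop :=
  exists a b c d e e' : R, [/\ a * d - b * c \is a GRing.unit,
    P' = a%:MP * P + b%:MP * Q + e%:MP & Q' = c%:MP * P + d%:MP * Q + e'%:MP].

Section AffineImage.
Variable R : comUnitRingType.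
Implicit Types P Q : {mpoly R[2]}.

Lemma affine_image_trans P Q P' Q' P'' Q'' :
  affine_image P Q P' Q' -> affine_image P' Q' P'' Q'' -> affine_image P Q P'' Q''.
Proof.
case=> a [b [c [d [e [e' [u -> ->]]]]]] [a' [b' [c' [d' [g [g' [u' -> ->]]]]]]].
exists (a' * a + b' * c), (a' * b + b' * d), (c' * a + d' * c), (c' * b + d' * d).
exists (a' * e + b' * e' + g), (c' * e + d' * e' + g'); split.
- have -> : (a' * a + b' * c) * (c' * b + d' * d) - (a' * b + b' * d) * (c' * a + d' * c)
    = (a' * d' - b' * c') * (a * d - b * c) by ring.
  by rewrite unitrM u u'.
- rewrite !(rmorphM, rmorphD) /=; ring.
- rewrite !(rmorphM, rmorphD) /=; ring.
Qed.

Lemma affine_image_sym P Q P' Q' : affine_image P Q P' Q' -> affine_image P' Q' P Q.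
Proof.
case=> a [b [c [d [e [e' [u -> ->]]]]]].
have uK := mulVr u; move: (_ ^-1) uK => v uK.
exists (v * d), (- v * b), (- v * c), (v * a).
exists (v * (b * e' - d * e)), (v * (c * e - a * e')); split.
- have -> : v * d * (v * a) - - v * b * (- v * c) = v * (v * (a * d - b * c)) by ring.
  by rewrite uK mulr1; apply/unitrP; exists (a * d - b * c); rewrite mulrC uK.
- transitivity ((v * (a * d - b * c))%:MP * P); first by rewrite uK mul1r.
  rewrite !(rmorphM, rmorphD, rmorphN) /=; ring.
- transitivity ((v * (a * d - b * c))%:MP * Q); first by rewrite uK mul1r.
  rewrite !(rmorphM, rmorphD, rmorphN) /=; ring.
Qed.

Lemma affine_image_swap P Q : affine_image P Q Q P.
Proof.
exists 0, 1, 1, 0, 0, 0; split; rewrite ?mpolyC0 ?mpolyC1; [|by ring..].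
by rewrite mul0r mul1r sub0r unitrN unitr1.
Qed.

Lemma affine_image_refl P Q : affine_image P Q P Q.
Proof.
exists 1, 0, 0, 1, 0, 0; split; rewrite ?mpolyC0 ?mpolyC1; [|by ring..].
by rewrite mul0r mul1r subr0 unitr1.
Qed.

End AffineImage.

Section TamePair.
Variable R : idomainType.
Implicit Types (P Q S : {mpoly R[2]}) (r : {poly R}).

(* In R[s][t], with x_1 = s t and x_2 = t, the degree in t is the total degree and the
   leading coefficient dehomogenizes the form of highest degree. *)
Definition phi : {mpoly R[2]} -> {poly {poly R}} :=
  mmap (polyC \o polyC) (fun k => if k == ord0 then 'X%:P * 'X else 'X).
HB.instance Definition _ := GRing.RMorphism.on phi.

Lemma phiC c : phi c%:MP = c%:P%:P.
Proof. by rewrite /phi mmapC. Qed.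

Lemma phiX k : phi 'X_k = if k == ord0 then 'X%:P * 'X else 'X.
Proof. by rewrite /phi mmapX mmap1U. Qed.

Lemma size_phiX k : size (phi 'X_k) = 2.
Proof.
rewrite phiX; case: ifP => _; last by rewrite size_polyX.
by rewrite size_Cmul ?polyX_eq0 // size_polyX.
Qed.

Definition mhorner P : {poly R} -> {mpoly R[2]} :=
  horner_eval P \o map_poly (@mpolyC 2 R).
HB.instance Definition _ P := GRing.RMorphism.on (mhorner P).

Lemma mhornerC P c : mhorner P c%:P = c%:MP.
Proof. by rewrite /mhorner /= map_polyC /horner_eval hornerC. Qed.

Lemma mhornerX P : mhorner P 'X = P.
Proof. by rewrite /mhorner /= map_polyX /horner_eval hornerX. Qed.

Lemma morph_mhorner (chi : {rmorphism {mpoly R[2]} -> {poly {poly R}}}) P r :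
  (forall c, chi c%:MP = c%:P%:P) ->
  chi (mhorner P r) = map_poly polyC r \Po chi P.
Proof.
move=> chiC; elim/poly_ind: r => [|r c IH]; first by rewrite !rmorph0.
rewrite !(rmorphD, rmorphM) /= mhornerX mhornerC IH map_polyX map_polyC /=.
by rewrite comp_polyX comp_polyC chiC.
Qed.

Lemma phi_mhorner P r : phi (mhorner P r) = map_poly polyC r \Po phi P.
Proof. exact: (morph_mhorner P r phiC). Qed.

Lemma size_comp_gt1 r (w : {poly {poly R}}) : (1 < size w)%N -> (1 < size r)%N ->
  size (map_poly polyC r \Po w) = ((size r).-1 * (size w).-1).+1.
Proof.
move=> w1 r1; rewrite -[in RHS](size_map_polyC r) -size_comp_poly prednK //.
rewrite lt0n size_poly_eq0 comp_poly_eq0 // -size_poly_eq0 size_map_polyC.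
by case: (size r) r1.
Qed.

Lemma lead_coef_comp_polyC r (w : {poly {poly R}}) : (1 < size w)%N ->
  lead_coef (map_poly polyC r \Po w) = (lead_coef r)%:P * lead_coef w ^+ (size r).-1.
Proof.
move=> w1; rewrite lead_coef_comp // size_map_polyC lead_coef_map_inj //.
exact: polyC_inj.
Qed.

(* Images of (x_1, x_2) under tame automorphisms.  In a shear, Q may have any degree up to
   deg P, so that composing with a shear whose leading term cancels that of r only
   replaces r (see tame_pair_elementary); no normal form is needed. *)
Inductive tame_pair : {mpoly R[2]} -> {mpoly R[2]} -> Prop :=
  | TP_affine P Q : affine_image 'X_ord0 'X_ord_max P Q -> tame_pair P Q
  | TP_shear P Q r P' Q' : tame_pair P Q -> (size (phi Q) <= size (phi P))%N ->
      (2 < size r)%N -> affine_image P (Q + mhorner P r) P' Q' -> tame_pair P' Q'.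

Lemma tame_pair_affine P Q P' Q' :
  tame_pair P Q -> affine_image P Q P' Q' -> tame_pair P' Q'.
Proof.
move=> tpq; case: tpq P' Q' => {}P {}Q.
  by move=> h P' Q' h'; apply: TP_affine; apply: affine_image_trans h h'.
move=> r P1 Q1 tpq s1 s2 h P' Q' h'.
by apply: TP_shear tpq s1 s2 _; apply: affine_image_trans h h'.
Qed.

Lemma size_affine_image P Q P' Q' n : (0 < n)%N -> affine_image P Q P' Q' ->
  (size (phi P) <= n)%N -> (size (phi Q) <= n)%N ->
  (size (phi P') <= n)%N /\ (size (phi Q') <= n)%N.
Proof.
move=> n0 [a [b [c [d [e [e' [u -> ->]]]]]]] sP sQ.
have h (x y z : R) : (size (phi (x%:MP * P + y%:MP * Q + z%:MP)) <= n)%N.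
  rewrite !(rmorphD, rmorphM) /= !phiC !mul_polyC.
  rewrite (leq_trans (size_polyD _ _)) // geq_max (leq_trans (size_polyC_leq1 _)) // andbT.
  by rewrite (leq_trans (size_polyD _ _)) // geq_max !(leq_trans (size_scale_leq _ _)).
by split; apply: h.
Qed.

(** An affine image can be inverted, so two constant components would force constant components one
    stage earlier, down to the variables. This gives the nonconstancy under which degrees multiply
    in a shear. *)
Lemma tame_pair_size P Q : tame_pair P Q -> (1 < size (phi P))%N || (1 < size (phi Q))%N.
Proof.
elim=> {P Q} [P Q|P Q r P' Q' _ IH s1 s2] h; apply/negPn/negP;
  rewrite negb_or -!leqNgt => /andP [sP sQ];
  have [s _] := size_affine_image (ltn0Sn 0) (affine_image_sym h) sP sQ.
  by move: s; rewrite size_phiX.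
by move: IH; rewrite ltnNge s /= ltnNge (leq_trans s1 s).
Qed.

Lemma tame_pair_size_top P Q : tame_pair P Q -> (size (phi Q) <= size (phi P))%N ->
  (1 < size (phi P))%N.
Proof. by move/tame_pair_size => /orP [//|/leq_trans h] /h. Qed.

(** As [r] has degree at least 2 and [P] is nonconstant, r(P) has larger degree than [P], hence than
    [Q]. The leading form is thus a constant of [R] times a power of that of [P]. *)
Lemma size_shear P Q r : (1 < size (phi P))%N -> (size (phi Q) <= size (phi P))%N ->
  (2 < size r)%N ->
  size (phi (Q + mhorner P r)) = ((size r).-1 * (size (phi P)).-1).+1 /\
  lead_coef (phi (Q + mhorner P r)) = (lead_coef r)%:P * lead_coef (phi P) ^+ (size r).-1.
Proof.
move=> sP sQ sr; rewrite rmorphD /= phi_mhorner.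
have sr1 : (1 < size r)%N by apply: ltnW.
have lt : (size (phi Q) < size (map_poly polyC r \Po phi P))%N.
  rewrite size_comp_gt1 //; apply: leq_ltn_trans sQ _.
  move: (size r) (size (phi P)) sr sP => x y; nia.
rewrite addrC size_polyDl // lead_coefDl // size_comp_gt1 //.
by rewrite lead_coef_comp_polyC.
Qed.

Lemma mhorner_small P r : (size r <= 2)%N ->
  mhorner P r = (r`_1)%:MP * P + (r`_0)%:MP.
Proof.
move=> sr; have -> : r = r`_1 *: 'X + (r`_0)%:P.
  apply/polyP => -[|[|k]]; rewrite coefD coefZ coefX coefC /= ?mulr0 ?mulr1 ?add0r ?addr0 //.
  by rewrite nth_default // (leq_trans sr).
set a := r`_1; set b := r`_0.
have -> : (a *: 'X + b%:P)`_1 = a by rewrite coefD coefZ coefX coefC mulr1 addr0.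
have -> : (a *: 'X + b%:P)`_0 = b by rewrite coefD coefZ coefX coefC mulr0 add0r.
by rewrite -mul_polyC rmorphD rmorphM /= mhornerX !mhornerC.
Qed.

Lemma mhorner_comp P r (s : {poly R}) :
  mhorner P (r \Po s) = mhorner (mhorner P s) r.
Proof.
elim/poly_ind: r => [|r c IH]; first by rewrite comp_poly0 !rmorph0.
by rewrite comp_polyD comp_polyM comp_polyX comp_polyC !(rmorphD, rmorphM) /= IH
  mhornerX !mhornerC.
Qed.

Lemma size_phi_affine (a b e : R) : (a != 0) || (b != 0) ->
  size (phi (a%:MP * 'X_ord0 + b%:MP * 'X_ord_max + e%:MP)) = 2.
Proof.
move=> nab; apply/eqP; rewrite eqn_leq.
have -> : phi (a%:MP * 'X_ord0 + b%:MP * 'X_ord_max + e%:MP)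
    = (a *: 'X + b%:P) *: 'X + (e%:P)%:P.
  rewrite !(rmorphD, rmorphM) /= !phiC !phiX /= !mul_polyC scalerDl.
  by rewrite scalerA mul_polyC.
rewrite (leq_trans (size_polyD _ _)) ?geq_max; last first.
  rewrite (leq_trans (size_scale_leq _ _)) ?size_polyX //.
  exact: leq_trans (size_polyC_leq1 _) _.
rewrite ltnNge; apply/negP => /leq_sizeP/(_ 1 isT).
rewrite coefD coefZ coefX coefC /= mulr1 addr0 => /polyP h.
move: (h 0%N) (h 1%N); rewrite !coefD !coefZ !coefX !coefC /= !(mulr0, mulr1, addr0, add0r).
by move=> hb ha; move: nab; rewrite ha hb eqxx.
Qed.

Lemma det_row_neq0 (a b c d : R) : a * d - b * c \is a GRing.unit ->
  ((a != 0) || (b != 0)) && ((c != 0) || (d != 0)).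
Proof.
move=> u; apply/andP; split; apply/negPn/negP; rewrite negb_or !negbK => /andP [/eqP e1 /eqP e2];
  by move: u; rewrite e1 e2 ?(mul0r, mulr0) subrr unitr0.
Qed.

Lemma tame_pair_shear P Q (u : R) r : u \is a GRing.unit -> tame_pair P Q ->
  (size (phi P) <= size (phi Q))%N -> (2 < size r)%N ->
  tame_pair (u%:MP * P + mhorner Q r) Q.
Proof.
move=> uu tpq s sr.
have aff : affine_image P Q Q (u%:MP * P).
  exists 0, 1, u, 0, 0, 0; split; rewrite ?mpolyC0 ?mpolyC1; [|by ring..].
  by rewrite mul0r mul1r sub0r unitrN.
apply: (TP_shear (tame_pair_affine tpq aff) _ sr (affine_image_swap _ _)).
by rewrite rmorphM /= phiC mul_polyC (leq_trans (size_scale_leq _ _)).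
Qed.

(** Closure under elementary automorphisms. If [Q] has top degree, a new shear is stacked on the
    pair; otherwise [Q] is an affine function of the base [P0] of the last shear, and the change is
    absorbed into that shear. *)
Lemma tame_pair_elementary P Q (u : R) r : u \is a GRing.unit -> tame_pair P Q ->
  tame_pair (u%:MP * P + mhorner Q r) Q.
Proof.
move=> uu tpq; have [sr|sr] := leqP (size r) 2.
  apply: (tame_pair_affine tpq); rewrite (mhorner_small _ sr).
  exists u, r`_1, 0, 1, r`_0, 0; split; rewrite ?mpolyC0 ?mpolyC1; [|by ring..].
  by rewrite mulr1 mulr0 subr0.
case: (tpq) => {tpq}[{}P {}Q h|P0 Q0 r0 {}P {}Q tpq s0 sr0 h].
  apply: tame_pair_shear => //; first exact: TP_affine.
  case: h => a [b [c [d [e [e' [/det_row_neq0/andP [n1 n2] -> ->]]]]]].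
  by rewrite !size_phi_affine.
have s1 := tame_pair_size_top tpq s0.
have [sS lS] := size_shear s1 s0 sr0.
have h' := h; case: h' => a [b [c [d [e [e' [ud defP defQ]]]]]].
have ltS : (size (phi P0) < size (phi (Q0 + mhorner P0 r0)))%N.
  by rewrite sS; move: (size r0) (size (phi P0)) sr0 s1 => x y; nia.
(* The entry [d] tells whether [Q] contains the sheared component, which has the larger degree. *)
have [d0|d0] := eqVneq d 0; last first.
  apply: tame_pair_shear => //; first exact: (TP_shear tpq s0 sr0).
  move: (Q0 + mhorner P0 r0) ltS h defQ => S ltS h defQ.
  have -> : size (phi Q) = size (phi S).
    have -> : phi Q = d%:P *: phi S + (c%:P *: phi P0 + e'%:P%:P).
      by rewrite defQ !(rmorphD, rmorphM) /= !phiC !mul_polyC [_ *: _ + _ *: _]addrC addrA.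
    rewrite size_polyDl size_scale ?polyC_eq0 //.
    apply: leq_ltn_trans (size_polyD _ _) _; rewrite gtn_max.
    rewrite (leq_ltn_trans (size_scale_leq _ _)) //=.
    by rewrite (leq_ltn_trans (size_polyC_leq1 _)) // (leq_ltn_trans _ ltS) // ltnW.
  by have [] := size_affine_image (leq_ltn_trans (leq0n _) ltS) h (ltnW ltS) (leqnn _).
move: ud; rewrite d0 mulr0 sub0r unitrN unitrM => /andP [ub uc].
set w := u * b; have uw : w \is a GRing.unit by rewrite unitrM uu ub.
(* Now [Q] is c P0 + e', so r(Q) is a polynomial in [P0]; dividing by the unit [w] merges it with
   [r0]. The sum may drop to degree at most 1, and then the shear disappears. *)
pose r' := r0 + (w^-1)%:P * ((u * a)%:P * 'X + (u * e)%:P + (r \Po (c%:P * 'X + e'%:P))).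
have E : u%:MP * P + mhorner Q r = w%:MP * (Q0 + mhorner P0 r').
  have hD x y r1 : mhorner P0 (x%:P * 'X + y%:P + r1) = x%:MP * P0 + y%:MP + mhorner P0 r1.
    by rewrite !(rmorphD, rmorphM) /= mhornerX !mhornerC.
  have hQ : mhorner P0 (c%:P * 'X + e'%:P) = Q.
    by rewrite rmorphD rmorphM /= mhornerX !mhornerC defQ d0 mpolyC0 mul0r addr0.
  have -> : mhorner P0 r' = mhorner P0 r0
      + (w^-1)%:MP * ((u * a)%:MP * P0 + (u * e)%:MP + mhorner Q r).
    rewrite /r' rmorphD /= rmorphM /= mhornerC; congr (_ + _ * _).
    by rewrite hD mhorner_comp hQ.
  have wK : w%:MP * (w^-1)%:MP = 1 :> {mpoly R[2]} by rewrite -rmorphM /= mulrV.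
  rewrite mulrDr [_ * (_ + _ * _)]mulrDr [w%:MP * ((w^-1)%:MP * _)]mulrA wK mul1r defP.
  rewrite /w !rmorphM /=; ring.
rewrite E.
have [sr'|sr'] := leqP (size r') 2; last first.
  apply: (TP_shear tpq s0 sr'); rewrite defQ d0.
  exists 0, w, c, 0, 0, e'; split; rewrite ?mpolyC0; [|by ring..].
  by rewrite mul0r sub0r unitrN unitrM uw uc.
apply: (tame_pair_affine tpq); rewrite defQ d0 (mhorner_small _ sr').
exists (w * r'`_1), w, c, 0, (w * r'`_0), e'; split; rewrite ?mpolyC0 ?rmorphM /=; [|by ring..].
by rewrite mulr0 sub0r unitrN unitrM uw uc.
Qed.
End TamePair.

(** * Affine and elementary automorphisms over a domain *)

Section Generators.
Variable R : idomainType.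
Implicit Types (s t w : 2.-tuple {mpoly R[2]}) (p H : {mpoly R[2]}).

(** Over R[x_j] the component [tnth t i] is a polynomial in x_i with a compositional left inverse.
    Degrees multiply, so it has degree 1, and its leading coefficient is a unit of R[x_j], hence a
    unit constant because [R] is a domain. *)
Lemma elementary_form (i j : 'I_2) s t : i != j ->
  cancel (comp_mpoly t) (comp_mpoly s) -> cancel (comp_mpoly s) (comp_mpoly t) ->
  tnth t j = 'X_j ->
  exists (u : R) (r : {poly R}), u \is a GRing.unit /\
    tnth t i = u%:MP * 'X_i + mhorner 'X_j r.
Proof.
move=> nij tK sK tj; pose W := psi i (tnth t i); pose H := tnth s i.
have psiH : psi i H \Po W = 'X.
  rewrite -(psiXi R i) -(sK 'X_i) comp_mpolyXt -/H; apply/esym.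
  apply: (@morph_mpoly2_eq R {poly {poly R}} (polyC \o polyC)
    (psi i \o comp_mpoly t) (comp_poly W \o psi i)) => [c|c|k] /=.
  - by rewrite comp_mpolyC psiC.
  - by rewrite psiC comp_polyC.
  rewrite comp_mpolyXt; have [->|/(ord2P nij)->] := eqVneq k i.
    by rewrite psiXi comp_polyX.
  by rewrite tj (psiXj _ nij) comp_polyC.
have : ((size (psi i H)).-1 * (size W).-1 == 1)%N.
  by rewrite -size_comp_poly psiH size_polyX.
rewrite muln_eq1 => /andP [sH sW].
have {}sH : size (psi i H) = 2 by move: sH; case: (size _) => [|[|[]]].
have {}sW : size W = 2 by move: sW; case: (size _) => [|[|[]]].
have : lead_coef (psi i H) * W`_1 = 1.
  by rewrite -[RHS](lead_coefX {poly R}) -psiH lead_coef_comp ?sW // sH expr1 [lead_coef W]lead_coefE sW.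
move=> hl; have : W`_1 \is a GRing.unit by apply/unitrPr; exists (lead_coef (psi i H)); rewrite mulrC hl.
rewrite poly_unitE => /andP [/eqP sW1 uW]; exists W`_1`_0, W`_0; split => //.
apply: (@psi_inj R i); rewrite -/W rmorphD rmorphM /= psiC psiXi.
rewrite (morph_mhorner _ _ (psiC i)) /= (psiXj _ nij) comp_polyCr.
have -> : (map_poly polyC W`_0).['X] = W`_0 by rewrite -[RHS]comp_polyXr.
rewrite -(size1_polyC _) ?sW1 //.
apply/polyP => -[|[|k]]; rewrite coefD coefMX coefC /= ?add0r ?coefC ?addr0 //=.
by rewrite nth_default ?sW.
Qed.

Lemma affine_form p : (msize p <= 2)%N ->
  p = (p@_U_(ord0))%:MP * 'X_ord0 + (p@_U_(ord_max))%:MP * 'X_ord_max + (p@_0)%:MP.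
Proof.
move=> sp; apply/mpolyP => m; have n01 : ord0 != ord_max :> 'I_2 by [].
have [dm|dm] := leqP 2 (mdeg m).
  rewrite memN_msupp_eq0 ?msize_mdeg_ge ?(leq_trans sp) //.
  rewrite memN_msupp_eq0 ?msize_mdeg_ge ?(leq_trans _ dm) //.
  do 2!(apply: leq_trans (msizeD_le _ _) _; rewrite geq_max ?msizeC ?(leq_trans (leq_b1 _)) ?andbT //).
  by rewrite !mul_mpolyC !(leq_trans (msizeZ_le _ _)) // msizeX mdeg1.
have [m0|nm0] := eqVneq m 0%MM.
  by rewrite m0 !mcoeffD !mcoeffCM !mcoeffX mcoeffC !mnm1_eq0 !mulr0 !add0r eqxx mulr1.
have [k ->] : exists k, m = U_(k)%MM.
  have /mdeg1P [k /eqP ->] : mdeg m == 1%N by rewrite eqn_leq -ltnS dm lt0n mdeg_eq0.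
  by exists k.
rewrite (mcoeff_affine n01); case: eqVneq => [->//|nk].
by rewrite (ord2P n01 nk).
Qed.

(* Linear coefficients modulo 'X^2 play the role of the Jacobian matrix. *)
Definition line_at (e e' y z : R) : {mpoly R[2]} -> {poly R} :=
  mmap polyC (fun k => if k == ord0 then y%:P * 'X + e%:P else z%:P * 'X + e'%:P).
HB.instance Definition _ e e' y z := GRing.RMorphism.on (line_at e e' y z).

Lemma line_atC e e' y z c : line_at e e' y z c%:MP = c%:P.
Proof. by rewrite /line_at mmapC. Qed.

Lemma line_atX e e' y z k : line_at e e' y z 'X_k =
  if k == ord0 then y%:P * 'X + e%:P else z%:P * 'X + e'%:P.
Proof. by rewrite /line_at mmapX mmap1U. Qed.

(** First-order Taylor expansion at [(e, e')]: [h0] is the value and [h1], [h2] are the partial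
    derivatives, independent of the direction [(y, z)]. *)
Lemma line_at_linear e e' p : exists h0 h1 h2, forall y z,
  (line_at e e' y z p)`_0 = h0 /\ (line_at e e' y z p)`_1 = h1 * y + h2 * z.
Proof.
pose L q := exists h0 h1 h2, forall y z,
  (line_at e e' y z q)`_0 = h0 /\ (line_at e e' y z q)`_1 = h1 * y + h2 * z.
have LM q q' : L q -> L q' -> L (q * q').
  move=> [a0 [a1 [a2 ha]]] [b0 [b1 [b2 hb]]].
  exists (a0 * b0), (a0 * b1 + a1 * b0), (a0 * b2 + a2 * b0) => y z.
  have [e1 e2] := ha y z; have [e3 e4] := hb y z.
  rewrite rmorphM /= !coefM !big_ord_recl !big_ord0 /= e1 e2 e3 e4; split; ring.
have LC c : L c%:MP.
  by exists c, 0, 0 => y z; rewrite line_atC !coefC /= !mul0r addr0.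
have LD q q' : L q -> L q' -> L (q + q').
  move=> [a0 [a1 [a2 ha]]] [b0 [b1 [b2 hb]]].
  exists (a0 + b0), (a1 + b1), (a2 + b2) => y z.
  have [e1 e2] := ha y z; have [e3 e4] := hb y z.
  rewrite rmorphD /= !coefD e1 e2 e3 e4; split; ring.
have LX k : L 'X_k.
  exists (if k == ord0 then e else e'), (k == ord0)%:R, (k != ord0)%:R => y z.
  rewrite line_atX; case: ifP => _; rewrite !coefD !coefMX !coefC /=; split; ring.
have LXn q n : L q -> L (q ^+ n).
  by move=> Lq; elim: n => [|n IH]; rewrite ?expr0 -?mpolyC1 // exprS; apply: LM.
change (L p); rewrite [p]mpolyE; apply: big_ind => //; first by rewrite -mpolyC0.
move=> m _; rewrite -mul_mpolyC; apply: (LM) => //; rewrite mpolyXE_id.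
by apply: big_ind => [||k _]; [rewrite -mpolyC1; apply: LC | apply: LM | apply: LXn; apply: LX].
Qed.

(** Chain rule: the Jacobian matrix of [s] at [(e, e')] times the linear part of [t] is the
    identity, so the determinant of the linear part is a unit. *)
Lemma affine_unit s t : cancel (comp_mpoly s) (comp_mpoly t) ->
  (msize (tnth t ord0) <= 2)%N -> (msize (tnth t ord_max) <= 2)%N ->
  affine_image 'X_ord0 'X_ord_max (tnth t ord0) (tnth t ord_max).
Proof.
move=> sK /affine_form t0 /affine_form t1.
move: (_@__) t0 => a; move: (_@__) => b; move: (_@__) => e t0.
move: (_@__) t1 => c; move: (_@__) => d; move: (_@__) => e' t1.
exists a, b, c, d, e, e'; split => //.
have lin k : exists h1 h2, forall x y : R,
    (line_at 0 0 x y 'X_k)`_1 = h1 * (a * x + b * y) + h2 * (c * x + d * y).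
  have [h0 [h1 [h2 h]]] := line_at_linear e e' (tnth s k).
  exists h1, h2 => x y; have [_ <-] := h (a * x + b * y) (c * x + d * y).
  rewrite -(sK 'X_k) comp_mpolyXt; apply: (congr1 (fun q : {poly R} => q`_1)).
  apply: (@morph_mpoly2_eq R {poly R} polyC (line_at 0 0 x y \o comp_mpoly t)
    (line_at e e' (a * x + b * y) (c * x + d * y))) => [g|g|l] /=.
  - by rewrite comp_mpolyC line_atC.
  - by rewrite line_atC.
  rewrite comp_mpolyXt line_atX; have n01 : ord0 != ord_max :> 'I_2 by [].
  have [->|/(ord2P n01)->] := eqVneq l ord0; rewrite ?t0 ?t1 !(rmorphD, rmorphM) /= !line_atC !line_atX /=.
    by rewrite polyC0 !addr0; ring.
  by rewrite polyC0 !addr0; ring.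
have [h1 [h2 h]] := lin ord0; have [g1 [g2 g]] := lin ord_max.
(* The witness is the Jacobian determinant of [s] at [(e, e')]. *)
apply/unitrPr; exists (h1 * g2 - h2 * g1); rewrite mulrC.
move: (h 1 0) (h 0 1) (g 1 0) (g 0 1).
rewrite !line_atX /= !coefD !coefMX !coefC /= !addr0 !mulr0 !mulr1 !addr0 !add0r => k1 k2 k3 k4.
suff -> : (h1 * g2 - h2 * g1) * (a * d - b * c) = 1 by [].
transitivity ((h1 * a + h2 * c) * (g1 * b + g2 * d) - (h1 * b + h2 * d) * (g1 * a + g2 * c)); first by ring.
by rewrite -k1 -k2 -k3 -k4 mulr1 mulr0 subr0.
Qed.
End Generators.

(** * From the tame group to tame pairs *)

Section TameGroup.
Variable R : idomainType.
Implicit Types (s t w : 2.-tuple {mpoly R[2]}) (F G : {mpoly R[2]} -> {mpoly R[2]}).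

(** Quantifying over all tame pairs [w], not just the variables, makes the property stable under
    composition; the identity tuple later recovers the pair of [t] itself. *)
Definition preserves_tame t := forall w,
  tame_pair (tnth w ord0) (tnth w ord_max) ->
  tame_pair (tnth t ord0 \mPo w) (tnth t ord_max \mPo w).

Lemma affine_preserves t :
  affine_image 'X_ord0 'X_ord_max (tnth t ord0) (tnth t ord_max) -> preserves_tame t.
Proof.
case=> a [b [c [d [e [e' [u t0 t1]]]]]] w tw; rewrite t0 t1; apply: (tame_pair_affine tw).
exists a, b, c, d, e, e'; split => //.
  by rewrite !(rmorphD, rmorphM) /= !comp_mpolyC !comp_mpolyXt.
by rewrite !(rmorphD, rmorphM) /= !comp_mpolyC !comp_mpolyXt.
Qed.

Lemma tame_pair_swap (P Q : {mpoly R[2]}) : tame_pair P Q -> tame_pair Q P.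
Proof. by move=> h; apply: (tame_pair_affine h); apply: affine_image_swap. Qed.

Lemma comp_mhorner w (P : {mpoly R[2]}) r : mhorner P r \mPo w = mhorner (P \mPo w) r.
Proof.
elim/poly_ind: r => [|r c IH]; first by rewrite !rmorph0.
by rewrite !(rmorphD, rmorphM) /= !mhornerX !mhornerC IH comp_mpolyC.
Qed.

Lemma ord0_or_max (i j : 'I_2) : i != j ->
  (i = ord0 /\ j = ord_max) \/ (i = ord_max /\ j = ord0).
Proof.
case: i => -[|[|[]]] //= ?; case: j => -[|[|[]]] //= ? _; [left|right];
  by split; apply/val_inj.
Qed.

Lemma elementary_preserves (i j : 'I_2) s t : i != j ->
  cancel (comp_mpoly t) (comp_mpoly s) -> cancel (comp_mpoly s) (comp_mpoly t) ->
  tnth t j = 'X_j -> preserves_tame t.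
Proof.
move=> nij tK sK tj w tw.
have [u [r [uu ti]]] := elementary_form nij tK sK tj.
have h : tame_pair (tnth w i) (tnth w j) -> tame_pair (tnth t i \mPo w) (tnth t j \mPo w).
  move=> twij; rewrite ti tj rmorphD rmorphM /= comp_mhorner comp_mpolyC !comp_mpolyXt.
  exact: tame_pair_elementary.
case: (ord0_or_max nij) h => -[-> ->]; first exact.
by move=> h; apply: tame_pair_swap; apply: h; apply: tame_pair_swap.
Qed.

Lemma comp_comp_mpoly t t' (p : {mpoly R[2]}) :
  (p \mPo t') \mPo t = p \mPo [tuple tnth t' k \mPo t | k < 2].
Proof.
apply: (@morph_mpoly2_eq R {mpoly R[2]} (@mpolyC 2 R) (comp_mpoly t \o comp_mpoly t')
  (comp_mpoly [tuple tnth t' k \mPo t | k < 2])) => [c|c|k] /=; rewrite ?comp_mpolyC //.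
by rewrite !comp_mpolyXt tnth_mktuple.
Qed.

Lemma preserves_comp t t' : preserves_tame t -> preserves_tame t' ->
  preserves_tame [tuple tnth t' k \mPo t | k < 2].
Proof.
move=> ht ht' w tw; rewrite !tnth_mktuple !comp_comp_mpoly.
by apply: ht'; rewrite !tnth_mktuple; apply: ht.
Qed.

Lemma aut_tuples F : is_aut F -> exists s t, [/\ F =1 comp_mpoly t,
  cancel (comp_mpoly t) (comp_mpoly s) & cancel (comp_mpoly s) (comp_mpoly t)].
Proof.
case=> [[t Ft] [G FK GK]]; pose s := [tuple G 'X_k | k < 2].
have Gst p : (p \mPo s) \mPo t = p.
  by apply: (@comp_mpolyK _ t s) => k; rewrite tnth_mktuple -Ft GK.
exists s, t; split => // p.
by apply: (can_inj FK); rewrite !Ft Gst.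
Qed.

(** The inverse [s] is carried through the induction so that the inversion rule of [in_T] merely
    exchanges [s] and [t]. *)
Lemma in_T_preserves F : in_T F -> exists s t, [/\ F =1 comp_mpoly t,
  cancel (comp_mpoly t) (comp_mpoly s), cancel (comp_mpoly s) (comp_mpoly t),
  preserves_tame t & preserves_tame s].
Proof.
elim=> {F} [F [autF degF]|F [autF [i Fi]]|F G _ [s [t [Ft tK sK pt ps]]] _ [s' [t' [Gt tK' sK' pt' ps']]]
  |F G _ [s [t [Ft tK sK pt ps]]] FK GK|F G _ [s [t [Ft tK sK pt ps]]] FG].
- have [s [t [Ft tK sK]]] := aut_tuples autF; exists s, t.
  have msz k : (msize (tnth t k) <= 2)%N.
    by have := degF k; rewrite /tdeg Ft comp_mpolyXt; case: (msize _) => [|[|[]]].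
  have aff := affine_unit sK (msz _) (msz _).
  split => //; first exact: affine_preserves.
  apply: affine_preserves; apply: affine_image_sym.
  (* Substituting [s] into the affine formulas for [t] exhibits the variables as an affine image of
     the components of [s]. *)
  case: aff => a [b [c [d [e [e' [u t0 t1]]]]]]; exists a, b, c, d, e, e'; split => //.
    have := tK 'X_ord0; rewrite comp_mpolyXt t0 !(rmorphD, rmorphM) /=.
    by rewrite !comp_mpolyC !comp_mpolyXt.
  have := tK 'X_ord_max; rewrite comp_mpolyXt t1 !(rmorphD, rmorphM) /=.
  by rewrite !comp_mpolyC !comp_mpolyXt.
- have [s [t [Ft tK sK]]] := aut_tuples autF; exists s, t.
  have [j nij] := ord2_other i.
  have tj : tnth t j = 'X_j by rewrite -comp_mpolyXt -Ft Fi // eq_sym.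
  have sj : tnth s j = 'X_j by rewrite -comp_mpolyXt -{1}tj -comp_mpolyXt tK.
  split => //; first exact: (elementary_preserves nij tK sK tj).
  exact: (elementary_preserves nij sK tK sj).
- exists [tuple tnth s k \mPo s' | k < 2], [tuple tnth t' k \mPo t | k < 2]; split.
  + by move=> p /=; rewrite Gt Ft comp_comp_mpoly.
  + by move=> p; rewrite -!comp_comp_mpoly tK tK'.
  + by move=> p; rewrite -!comp_comp_mpoly sK' sK.
  + exact: preserves_comp.
  + exact: preserves_comp.
- exists t, s; split => // p.
  by apply: (can_inj FK); rewrite GK Ft sK.
- by exists s, t; split => // p; rewrite -FG Ft.
Qed.

Lemma in_T_tame_pair F : in_T F -> exists t, F =1 comp_mpoly t /\
  tame_pair (tnth t ord0) (tnth t ord_max).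
Proof.
case/in_T_preserves => s [t [Ft _ _ pt _]]; exists t; split => //.
have := pt [tuple 'X_k | k < 2]; rewrite !comp_mpoly_id; apply.
by rewrite !tnth_mktuple; apply: TP_affine; apply: affine_image_refl.
Qed.
End TameGroup.

(** * Stabilizers of reduced polynomials *)

Section Degrees.
Variable R : idomainType.
Implicit Types (f P Q : {mpoly R[2]}) (r : {poly R}) (i j : 'I_2).

(** Some monomial attains [m i = di], and the triangle inequality then forces [m j = 0]. *)
Lemma degx_corner i j f di dj : i != j -> degx i f = di -> (0 < di)%N ->
  (forall m, m \in msupp f -> (dj * m i + di * m j <= di * dj)%N) ->
  f@_(U_(i) *+ di)%MM != 0.
Proof.
move=> nij degf di0 tri.
have [/hasP [m mf /eqP mi]|/hasPn no] := boolP (has (fun m : 'X_{1..2} => m i == di) (msupp f)).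
  have mj : m j = 0%N.
    have tm := tri m mf; rewrite mi mulnC in tm.
    by have : (di * m j == 0)%N; [rewrite eqn_leq; lia | rewrite muln_eq0 gtn_eqF // => /eqP].
  suff <- : m = (U_(i) *+ di)%MM by rewrite -mcoeff_msupp.
  apply/mnmP => k; rewrite mulmnE mnm1E.
  by have [->|/(ord2P nij)->] := eqVneq k i; rewrite ?eqxx ?mul1n ?(negbTE nij).
have : (degx i f <= di.-1)%N.
  apply/bigmax_leqP_seq => m mf _; rewrite -ltnS prednK //.
  rewrite ltn_neqAle no //= -degf /degx.
  exact: (@leq_bigmax_seq _ _ predT (fun m : 'X_{1..2} => m i) m mf).
by rewrite degf -ltnS prednK // ltnn.
Qed.

(** If the two corners have images of different degree, the larger one survives and bounds both. If
    the degrees agree, the coefficient of [chi f] there is the edge part at the leading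
    coefficients, so only a zero of it allows cancellation. *)
Lemma dichotomy i j f di dj (chi : {rmorphism {mpoly R[2]} -> {poly {poly R}}}) :
  i != j -> (forall c, chi c%:MP = c%:P%:P) ->
  degx i f = di -> degx j f = dj -> (0 < di)%N -> (0 < dj)%N ->
  (forall m, m \in msupp f -> (dj * m i + di * m j <= di * dj)%N) ->
  (1 < size (chi 'X_i))%N || (1 < size (chi 'X_j))%N ->
  ((di * (size (chi 'X_i)).-1 < size (chi f)) &&
   (dj * (size (chi 'X_j)).-1 < size (chi f)))%N \/
  (di * (size (chi 'X_i)).-1 = dj * (size (chi 'X_j)).-1)%N /\
  wtop i j f di dj polyC (lead_coef (chi 'X_i)) (lead_coef (chi 'X_j)) = 0.
Proof.
move=> nij chiC edi edj di0 dj0 tri s1.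
have nji : j != i by rewrite eq_sym.
have tri' m : m \in msupp f -> (di * m j + dj * m i <= dj * di)%N.
  by move/tri; rewrite addnC [(dj * di)%N]mulnC.
have ci := degx_corner nij edi di0 tri; have cj := degx_corner nji edj dj0 tri'.
set p := (size (chi 'X_i)).-1; set q := (size (chi 'X_j)).-1.
have sp : (size (chi 'X_i) <= p.+1)%N by rewrite leqSpred.
have sq : (size (chi 'X_j) <= q.+1)%N by rewrite leqSpred.
case: (ltngtP (dj * q) (di * p)) => [lt|lt|eq].
- have p0 : (0 < p)%N by case: (p) lt => //; rewrite muln0 ltn0.
  have : (di * p < size (chi f))%N.
    apply: (@dominant_corner R i j nij f di dj tri _ polyC chi chiC (@polyC_inj R) p q) => //.
    by rewrite /p prednK // ltnW // -ltn_predRL.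
  by move=> h; left; rewrite h (ltn_trans lt h).
- have q0 : (0 < q)%N by case: (q) lt => //; rewrite muln0 ltn0.
  have : (dj * q < size (chi f))%N.
    apply: (@dominant_corner R j i nji f dj di tri' _ polyC chi chiC (@polyC_inj R) q p) => //.
    by rewrite /q prednK // ltnW // -ltn_predRL.
  by move=> h; left; rewrite h (ltn_trans lt h).
have mu0 : (0 < di * p)%N.
  case/orP: s1 => s1; first by rewrite muln_gt0 di0 /p ltn_predRL.
  by rewrite -eq muln_gt0 dj0 /q ltn_predRL.
have c := @coef_triangle R i j nij f di dj tri _ polyC chi chiC p q _ di0 dj0 mu0 sp sq erefl eq.
have [w0|w0] := eqVneq (wtop i j f di dj polyC (chi 'X_i)`_p (chi 'X_j)`_q) 0.
  by right; split.
left; rewrite eq andbb ltnNge; apply: contra w0 => h.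
by rewrite -c nth_default.
Qed.

Lemma size_phi_triangle i j f di dj n : i != j -> (0 < di)%N -> (0 < dj)%N ->
  (forall m, m \in msupp f -> (dj * m i + di * m j <= di * dj)%N) ->
  (di <= n)%N -> (dj <= n)%N -> (size (phi f) <= n.+1)%N.
Proof.
move=> nij di0 dj0 tri h1 h2.
by apply: (@size_triangle R i j nij f di dj tri _ polyC (@phi R) (@phiC R) 1 1 n);
  rewrite ?size_phiX ?muln1.
Qed.

Lemma lead_affine_top (A B : {poly {poly R}}) (a b e : R) :
  (size A < size B)%N -> (1 < size B)%N -> b != 0 ->
  size (a%:P *: A + b%:P *: B + e%:P%:P) = size B /\
  lead_coef (a%:P *: A + b%:P *: B + e%:P%:P) = b%:P * lead_coef B.
Proof.
move=> lt lt1 b0.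
have sB : size (b%:P *: B) = size B by rewrite size_scale // polyC_eq0.
have lt' : (size (a%:P *: A + e%:P%:P)%R < size (b%:P *: B)%R)%N.
  rewrite sB; apply: leq_ltn_trans (size_polyD _ _) _; rewrite gtn_max.
  by rewrite (leq_ltn_trans (size_scale_leq _ _)) //= (leq_ltn_trans (size_polyC_leq1 _)).
have -> : a%:P *: A + b%:P *: B + e%:P%:P = b%:P *: B + (a%:P *: A + e%:P%:P).
  by rewrite [a%:P *: A + _]addrC addrA.
by rewrite size_polyDl // lead_coefDl // lead_coefZ sB.
Qed.

Lemma phi_affine P Q (a b e : R) :
  phi (a%:MP * P + b%:MP * Q + e%:MP) = a%:P *: phi P + b%:P *: phi Q + e%:P%:P.
Proof.
by rewrite !rmorphD /= [X in X + _ + _]rmorphM [X in _ + X + _]rmorphM /= !phiC !mul_polyC.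
Qed.

Lemma size_shear_gt P Q r : (1 < size (phi P))%N -> (size (phi Q) <= size (phi P))%N ->
  (2 < size r)%N ->
  (size (phi P) < size (phi (Q + mhorner P r)))%N && (2 < size (phi (Q + mhorner P r)))%N.
Proof.
move=> sP sQ sr; have [-> _] := size_shear sP sQ sr.
by move: (size r) (size (phi P)) sr sP => x y; nia.
Qed.

Lemma tame_pair_small P Q : tame_pair P Q -> (size (phi P) <= 2)%N -> (size (phi Q) <= 2)%N ->
  affine_image 'X_ord0 'X_ord_max P Q.
Proof.
case=> [//|{}P {}Q r P' Q' tpq s0 sr h] sP sQ.
have s1 := tame_pair_size_top tpq s0; have /andP [_ lt] := size_shear_gt s1 s0 sr.
have [_ le] := size_affine_image (ltn0Sn 1) (affine_image_sym h) sP sQ.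
by move: lt; rewrite ltnNge le.
Qed.

Lemma affine_image_ord i j P Q : i != j -> affine_image 'X_ord0 'X_ord_max P Q ->
  affine_image 'X_i 'X_j P Q.
Proof.
move=> nij h; case: (ord0_or_max nij) => -[-> ->] //.
exact: affine_image_trans (affine_image_swap _ _) h.
Qed.
End Degrees.

(** * Equal degrees: the stabilizer is affine *)

Section EqualDegrees.
Variables (R : idomainType) (i j : 'I_2) (f : {mpoly R[2]}) (d : nat).
Hypotheses (nij : i != j) (d0 : (0 < d)%N) (edi : degx i f = d) (edj : degx j f = d).
Hypothesis tri : forall m, m \in msupp f -> (d * m i + d * m j <= d * d)%N.
Hypothesis reduced :
  forall tau, in_T tau -> (d + d <= degx i (tau f) + degx j (tau f))%N.

Lemma stabilizer_affine (t : 2.-tuple {mpoly R[2]}) :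
  tame_pair (tnth t i) (tnth t j) -> f \mPo t = f ->
  affine_image 'X_i 'X_j (tnth t i) (tnth t j).
Proof.
move=> tp ff; have sf := size_phi_triangle nij d0 d0 tri (leqnn d) (leqnn d).
have chiC c : (@phi R \o comp_mpoly t) c%:MP = c%:P%:P by rewrite /= comp_mpolyC phiC.
have := dichotomy nij chiC edi edj d0 d0 tri.
rewrite /= !comp_mpolyXt ff => /(_ (tame_pair_size tp)) [/andP [h1 h2]|[h1 h2]].
  apply: affine_image_ord nij (tame_pair_small tp _ _).
    by move: (leq_trans h1 sf); case: (size _) => [|[|[|x]]] //=; nia.
  by move: (leq_trans h2 sf); case: (size _) => [|[|[|x]]] //=; nia.
case: tp h1 h2 => [P Q h _ _|P0 Q0 r P Q tp s0 sr h]; first exact: affine_image_ord.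
have s1 := tame_pair_size_top tp s0.
have /andP [lt lt2] := size_shear_gt s1 s0 sr.
case: h => a [b [c [e [g [g' [u -> ->]]]]]].
rewrite !phi_affine; set A := phi P0 in s1 lt *; set B := phi (Q0 + _) in lt lt2 *.
move=> /eqP; rewrite eqn_pmul2l // => /eqP h1 h2.
have small (x y : R) : (size (x%:P *: A + 0%:P *: B + y%:P%:P)%R < size B)%N.
  rewrite polyC0 scale0r addr0; apply: leq_ltn_trans (size_polyD _ _) _; rewrite gtn_max.
  by rewrite (leq_ltn_trans (size_scale_leq _ _)) //= (leq_ltn_trans (size_polyC_leq1 _)) // ltnW.
(* Both components must contain [B], of larger degree than [A]: otherwise invertibility leaves [B]
   in exactly one of them, against the equality of degrees [h1]. *)
have [b0 e0] : b != 0 /\ e != 0.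
  have [eb|nb] := eqVneq b 0.
    have ne : e != 0 by apply: contraTneq u => e0; rewrite eb e0 mulr0 mul0r subrr unitr0.
    have [se _] := lead_affine_top c g' lt (ltnW lt2) ne.
    by move: h1 (small a g); rewrite se eb; move: (size _) (size _) lt2 => x y; lia.
  have [ee|//] := eqVneq e 0.
  have [se _] := lead_affine_top a g lt (ltnW lt2) nb.
  by move: h1 (small c g'); rewrite se ee; move: (size _) (size _) lt2 => x y; lia.
have [_ l1] := lead_affine_top a g lt (ltnW lt2) b0.
have [_ l2] := lead_affine_top c g' lt (ltnW lt2) e0.
(* Both leading coefficients are multiples of that of [B]. Homogeneity removes this factor and
   leaves a zero at [(b, e)], the second column of the matrix, to which [reduced_linear] applies
   after exchanging columns. *)
move: h2; rewrite l1 l2 ![_%:P * lead_coef B]mulrC -[lead_coef B]expr1.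
rewrite wtop_scale // => /eqP; rewrite mulf_eq0 expf_eq0 lead_coef_eq0 -size_poly_eq0.
rewrite gtn_eqF ?(ltn_trans _ lt2) // andbF /= => w0.
have := @reduced_linear R i j nij f d d tri d0 d0 reduced b a e c erefl.
by rewrite w0 -unitrN opprB => /(_ u).
Qed.
End EqualDegrees.

(** * Unequal degrees: the variable of larger degree is preserved *)

Section UnequalDegrees.
Variables (R : idomainType) (i j : 'I_2) (f : {mpoly R[2]}) (di dj : nat).
Hypotheses (nij : i != j) (dj0 : (0 < dj)%N) (lt_d : (dj < di)%N).
Hypotheses (edi : degx i f = di) (edj : degx j f = dj).
Hypothesis tri : forall m, m \in msupp f -> (dj * m i + di * m j <= di * dj)%N.
Hypothesis reduced :
  forall tau, in_T tau -> (di + dj <= degx i (tau f) + degx j (tau f))%N.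

Let di0 : (0 < di)%N. Proof. exact: leq_ltn_trans lt_d. Qed.

Lemma wtop_shear_neq0 (s : {poly R}) (c : R) k : di = (dj * k)%N -> s != 0 ->
  wtop i j f di dj polyC s (s ^+ k * c%:P) != 0.
Proof.
move=> ek s0; rewrite -[s in wtop _ _ _ _ _ _ s _]mulr1 -{1}[s]expr1.
rewrite wtop_scale ?muln1 // mulf_neq0 ?expf_neq0 //.
exact: (reduced_shear nij tri di0 dj0 reduced c ek).
Qed.

Lemma stabilizer_size (t : 2.-tuple {mpoly R[2]}) :
  tame_pair (tnth t i) (tnth t j) -> f \mPo t = f -> (size (phi (tnth t i)) <= 2)%N.
Proof.
move=> tp ff; have sf := size_phi_triangle nij di0 dj0 tri (leqnn di) (ltnW lt_d).
have chiC c : (@phi R \o comp_mpoly t) c%:MP = c%:P%:P by rewrite /= comp_mpolyC phiC.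
have := dichotomy nij chiC edi edj di0 dj0 tri.
rewrite /= !comp_mpolyXt ff => /(_ (tame_pair_size tp)) [/andP [h1 _]|[h1 h2]].
  by move: (leq_trans h1 sf) di0; case: (size _) => [|[|[|x]]] //=; nia.
case: tp h1 h2 => [P Q h _ _|P0 Q0 r P Q tp s0 sr h].
  by have [] := @size_affine_image R _ _ _ _ 2 isT h; rewrite ?size_phiX.
have s1 := tame_pair_size_top tp s0.
have /andP [lt lt2] := size_shear_gt s1 s0 sr.
have [sS lS] := size_shear s1 s0 sr.
case: h => a [b [c [e [g [g' [u -> ->]]]]]]; rewrite !phi_affine.
move: (phi (Q0 + _)) lt lt2 sS lS => B lt lt2 sS lS h1 h2.
have le2 (x y z : R) : (size (x%:P *: phi P0 + y%:P *: B + z%:P%:P)%R <= size B)%N.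
  rewrite (leq_trans (size_polyD _ _)) // geq_max.
  rewrite (leq_trans (size_polyC_leq1 _)) ?andbT ?(ltn_trans _ lt2) //.
  rewrite (leq_trans (size_polyD _ _)) // geq_max !(leq_trans (size_scale_leq _ _)) //.
  exact: ltnW.
(* With [b] nonzero the first component would have the top degree, and [dj < di] would contradict
   [h1]. *)
have [b0|b0] := eqVneq b 0; last first.
  have [su _] := lead_affine_top a g lt (ltnW lt2) b0.
  by move: h1 (le2 c e g'); rewrite su; move: (size _) (size _) lt2 => x y; nia.
move: u; rewrite b0 mul0r subr0 unitrM => /andP [ua ue].
have e0 : e != 0 by apply: contraTneq ue => ->; rewrite unitr0.
have a0 : a != 0 by apply: contraTneq ua => ->; rewrite unitr0.
have [sv lv] := lead_affine_top c g' lt (ltnW lt2) e0.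
have lt0 : (size (0%R : {poly {poly R}}) < size (phi P0))%N by rewrite size_poly0 ltnW.
have [su lu] := lead_affine_top 0 g lt0 s1 a0.
rewrite scaler0 add0r in su lu.
move: h1 h2; rewrite b0 polyC0 scale0r addr0 su sv lu lv sS lS /=.
set k := (size r).-1; set L := lead_coef (phi P0) => h1.
have ek : di = (dj * k)%N.
  apply/eqP; rewrite -(eqn_pmul2r (_ : 0 < (size (phi P0)).-1)%N) ?ltn_predRL //.
  by rewrite h1 mulnA.
(* Since [b = 0], the determinant is [a * e] and [a] is a unit. Hence the constant linking the
   leading forms lies in [R], as [wtop_shear_neq0] requires. *)
have -> : e%:P * ((lead_coef r)%:P * L ^+ k)
    = (a%:P * L) ^+ k * (e * lead_coef r * (a ^+ k)^-1)%:P.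
  have aK : (a ^+ k)%:P * ((a ^+ k)^-1)%:P = 1 :> {poly R}.
    by rewrite -polyCM mulrV // unitrX.
  rewrite exprMn -rmorphXn /= !polyCM.
  transitivity ((a ^+ k)%:P * ((a ^+ k)^-1)%:P * (e%:P * ((lead_coef r)%:P * L ^+ k))); first by rewrite aK mul1r.
  by move: (_ ^-1)%:P => x; ring.
move/eqP => w0; exfalso; move: w0; apply/negP; apply: wtop_shear_neq0 => //.
by rewrite mulf_neq0 ?polyC_eq0 // lead_coef_eq0 -size_poly_eq0 gtn_eqF // ltnW.
Qed.

Lemma stabilizer_form (t : 2.-tuple {mpoly R[2]}) :
  tame_pair (tnth t i) (tnth t j) -> f \mPo t = f ->
  exists (a b c d e : R) (r : {poly R}),
    tnth t i = a%:MP * 'X_i + b%:MP * 'X_j + e%:MP /\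
    tnth t j = c%:MP * 'X_i + d%:MP * 'X_j + mhorner (tnth t i) r.
Proof.
move=> tp ff; have := stabilizer_size tp ff.
case: tp => [P Q h _|P0 Q0 r P Q tp s0 sr h].
  have [a [b [c [d [e [e' [_ -> ->]]]]]]] := affine_image_ord nij h.
  by exists a, b, c, d, e, e'%:P; split => //; rewrite mhornerC.
have s1 := tame_pair_size_top tp s0.
have /andP [lt lt2] := size_shear_gt s1 s0 sr.
case: h => a [b [c [d [g [g' [u eP eQ]]]]]] sP; rewrite eP phi_affine in sP.
have [b0|b0] := eqVneq b 0; last first.
  by have [su _] := lead_affine_top a g lt (ltnW lt2) b0; rewrite su leqNgt lt2 in sP.
move: u; rewrite b0 mul0r subr0 unitrM => /andP [ua _].
rewrite b0 mpolyC0 mul0r addr0 in eP.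
have e0 : P0 = (a^-1)%:MP * P + (- a^-1 * g)%:MP.
  have aK : (a^-1)%:MP * a%:MP = 1 :> {mpoly R[2]} by rewrite -rmorphM /= mulVr.
  rewrite eP mulrDr mulrA aK mul1r -rmorphM -addrA -rmorphD /= -mulrDl subrr mul0r.
  by rewrite mpolyC0 addr0.
have sP0 : (size (phi P0) <= 2)%N.
  move: sP; rewrite b0 polyC0 scale0r addr0.
  have a0 : a != 0 by apply: contraTneq ua => ->; rewrite unitr0.
  have lt0 : (size (0%R : {poly {poly R}}) < size (phi P0))%N by rewrite size_poly0 ltnW.
  have [su _] := lead_affine_top 0 g lt0 s1 a0.
  by rewrite scaler0 add0r in su; rewrite su.
have h := affine_image_ord nij (tame_pair_small tp sP0 (leq_trans s0 sP0)).
case: h => a1 [b1 [c1 [d1 [g1 [g1' [_ eP0 eQ0]]]]]].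
exists (a * a1), (a * b1), (d * c1), (d * d1), (a * g1 + g).
pose r1 := c%:P * 'X + d%:P * (g1'%:P + r) + g'%:P.
(* The inner polynomial recovers [P0] from [P], so what was a polynomial in [P0] becomes one in
   [tnth t i]. *)
exists (r1 \Po ((a^-1)%:P * 'X + (- a^-1 * g)%:P)); split.
  by rewrite eP eP0 !(rmorphD, rmorphM) /=; ring.
have hP0 : mhorner P ((a^-1)%:P * 'X + (- a^-1 * g)%:P) = P0.
  by rewrite rmorphD /= [mhorner P (_ * _)]rmorphM /= mhornerX !mhornerC; exact: esym.
have hr1 : mhorner P0 r1 = c%:MP * P0 + d%:MP * (g1'%:MP + mhorner P0 r) + g'%:MP.
  by rewrite !(rmorphD, rmorphM) /= mhornerX !mhornerC.
rewrite mhorner_comp hP0 hr1 eQ eQ0 !rmorphM /=; ring.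
Qed.

(** On the line x_i = 0, [f] has degree at most [dj]. An x_j term in [tnth t i] would stay
    nonconstant there: without cancellation it forces [di <= dj], and with cancellation it gives a
    forbidden zero of the edge polynomial. *)
Lemma stabilizer_first (t : 2.-tuple {mpoly R[2]}) :
  tame_pair (tnth t i) (tnth t j) -> f \mPo t = f ->
  exists a e : R, tnth t i = a%:MP * 'X_i + e%:MP.
Proof.
move=> tp ff; have [a [b [c [d [e [r [ti tj]]]]]]] := stabilizer_form tp ff.
suff b0 : b = 0 by exists a, e; rewrite ti b0 mpolyC0 mul0r addr0.
apply/eqP; apply: contraT => b0.
pose zeta : {rmorphism {mpoly R[2]} -> {poly {poly R}}} :=
  mmap (polyC \o polyC) (fun k : 'I_2 => if k == i then 0 else 'X).
have zC c0 : zeta c0%:MP = c0%:P%:P by rewrite /zeta /= mmapC.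
have zi : zeta 'X_i = 0 by rewrite /zeta /= mmapX mmap1U eqxx.
have zj : zeta 'X_j = 'X by rewrite /zeta /= mmapX mmap1U eq_sym (negbTE nij).
have sf : (size (zeta f) <= dj.+1)%N.
  by apply: (@size_triangle R i j nij f di dj tri _ polyC zeta zC 0 1 dj);
    rewrite ?zi ?zj ?size_poly0 ?size_polyX ?muln0 ?muln1.
have chiC c0 : (zeta \o comp_mpoly t) c0%:MP = c0%:P%:P by rewrite /= comp_mpolyC zC.
pose u := b%:P *: 'X + e%:P%:P : {poly {poly R}}.
have ui : zeta (tnth t i) = u.
  by rewrite ti !(rmorphD, rmorphM) /= !zC zi zj mulr0 add0r mul_polyC.
have lt1 : (size (0%R : {poly {poly R}}) < size ('X : {poly {poly R}}))%N.
  by rewrite size_poly0 size_polyX.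
have [su lu] : size u = 2 /\ lead_coef u = b%:P.
  have := lead_affine_top 0 e lt1 _ b0; rewrite scaler0 add0r size_polyX lead_coefX mulr1.
  exact.
have vj : zeta (tnth t j) = d%:P *: 'X + (map_poly polyC r \Po u).
  rewrite tj !(rmorphD, rmorphM) /= !zC zi zj mulr0 add0r mul_polyC.
  by rewrite (morph_mhorner _ _ zC) ui.
have := dichotomy nij chiC edi edj di0 dj0 tri.
rewrite /= !comp_mpolyXt ff ui su /= muln1 => /(_ isT) [/andP [h1 _]|[h1 h2]].
  by move: (leq_trans h1 sf); rewrite ltnS leqNgt lt_d.
have sdX : (size (d%:P *: 'X : {poly {poly R}})%R <= 2)%N.
  by rewrite (leq_trans (size_scale_leq _ _)) ?size_polyX.
(* For [r] of degree at most 1 the second component has degree at most 1 on the line, so [h1] would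
   give [di <= dj]. *)
have [sr|sr] := leqP (size r) 2.
  have sv : (size (zeta (tnth t j)) <= 2)%N.
    by rewrite vj (leq_trans (size_polyD _ _)) // geq_max sdX /= size_comp_poly2 ?size_map_polyC.
  by move: sv h1 lt_d; case: (size _) => [|[|[|x]]] //=; nia.
have su1 : (1 < size u)%N by rewrite su.
have sc := size_comp_gt1 su1 (ltnW sr); rewrite su muln1 in sc.
have lc := lead_coef_comp_polyC r su1; rewrite lu in lc.
have ltc : (size (d%:P *: 'X : {poly {poly R}})%R < size (map_poly polyC r \Po u))%N.
  by rewrite sc prednK ?(leq_ltn_trans sdX) // (ltn_trans _ sr).
have sv : (size (zeta (tnth t j))).-1 = (size r).-1.
  by rewrite vj addrC size_polyDl // sc.
have lv : lead_coef (zeta (tnth t j)) = b%:P ^+ (size r).-1 * (lead_coef r)%:P.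
  by rewrite vj addrC lead_coefDl // lc mulrC.
move: h2; rewrite lu lv => /eqP w0; exfalso; move: w0; apply/negP; apply: wtop_shear_neq0.
  by rewrite h1 sv.
by rewrite polyC_eq0.
Qed.
End UnequalDegrees.

Lemma in_J_of_first (R : idomainType) (i j : 'I_2) F (t : 2.-tuple {mpoly R[2]}) (a e : R) :
  i != j -> is_aut F -> F =1 comp_mpoly t -> tnth t i = a%:MP * 'X_i + e%:MP ->
  in_J i F.
Proof.
move=> nij autF Ft ti; split=> // p pi.
have nji : j != i by rewrite eq_sym.
have psit : psi j (tnth t i) = (a *: 'X + e%:P)%:P.
  by rewrite ti !(rmorphD, rmorphM) /= !psiC (psiXj _ nji) -mul_polyC rmorphM.
have pE := @morph_mpoly2E R {poly {poly R}} (polyC \o polyC) (psi j \o comp_mpoly t)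
  i j p nij (fun c => etrans (congr1 (psi j) (comp_mpolyC c t)) (psiC j c)).
have sF : (size (psi j (F p)) <= 1)%N.
  rewrite Ft; rewrite /= in pE; rewrite pE; apply: leq_trans (size_sum _ _ _) _.
  rewrite big_seq; apply/bigmax_leqP_seq => m mp _.
  by rewrite (pi m mp j nji) comp_mpolyXt psit expr0 mulr1 -rmorphXn -rmorphM size_polyC_leq1.
move=> m mF k /(ord2P nij) ->; apply/eqP; rewrite -leqn0.
apply: leq_trans (degx_psi sF).
exact: (@leq_bigmax_seq _ _ predT (fun m : 'X_{1..2} => m j) m mF).
Qed.

Theorem theorem2p2p4 (R : idomainType) (f : {mpoly R[2]}) :
  (0 < degx ord0 f)%N -> (0 < degx (@Ordinal 2 1 isT) f)%N ->
  wdeg (degx (@Ordinal 2 1 isT) f, degx ord0 f) f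
    = (degx ord0 f * degx (@Ordinal 2 1 isT) f)%N ->
  tamely_reduced f ->
  (degx ord0 f = degx (@Ordinal 2 1 isT) f ->
     forall F, in_H f F -> is_affine F) /\
  (forall i j : 'I_2, i != j -> (degx j f < degx i f)%N ->
     forall F, in_H f F -> in_J i F).
Proof.
have o1 : @Ordinal 2 1 isT = ord_max by apply: val_inj.
rewrite /tamely_reduced /wdeg o1 /= => d0 d1 wd [_ red].
have n01 : ord0 != ord_max :> 'I_2 by [].
(* The weighted degree bounds the weight of every monomial, which places the support of [f] in the
   triangle. *)
have tri m : m \in msupp f -> (degx ord_max f * m ord0 + degx ord0 f * m ord_max
    <= degx ord0 f * degx ord_max f)%N.
  move=> mf; rewrite -wd.
  exact: (@leq_bigmax_seq _ _ predT (fun m : 'X_{1..2} =>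
    (degx ord_max f * m ord0 + degx ord0 f * m ord_max)%N) m mf).
split=> [ed F [autF [Ff TF]]|i j nij lt F [autF [Ff TF]]];
  have [t [Ft tp]] := in_T_tame_pair TF; have ft : f \mPo t = f by rewrite -Ft.
  rewrite -ed in tri red.
  have h := @stabilizer_affine R ord0 ord_max f _ n01 d0 erefl (esym ed) tri red t tp ft.
  case: h => a [b [c [d [e [e' [u t0 t1]]]]]]; have /andP [ab cd] := det_row_neq0 u.
  (* A unit determinant leaves no zero row, so each image has degree exactly 1. *)
  split=> // k; rewrite Ft comp_mpolyXt.
  by have [->|/(ord2P n01)->] := eqVneq k ord0; rewrite ?t0 ?t1 tdeg_affine.
have [dj0 trij redj tpj] : [/\ (0 < degx j f)%N,
    forall m, m \in msupp f -> (degx j f * m i + degx i f * m j <= degx i f * degx j f)%N,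
    forall tau, in_T tau -> (degx i f + degx j f <= degx i (tau f) + degx j (tau f))%N &
    tame_pair (tnth t i) (tnth t j)].
  case: (ord0_or_max nij) => -[-> ->]; split=> //.
  - by move=> m /tri; rewrite addnC mulnC [X in (_ <= X)%N]mulnC.
  - by move=> tau /red; rewrite addnC [X in (_ <= X)%N]addnC.
  - exact: tame_pair_swap.
have [a [e ti]] := stabilizer_first nij dj0 lt erefl erefl trij redj tpj ft.
exact: in_J_of_first nij autF Ft ti.
Qed.
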